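(* Let $N\ge 1$ and consider an undirected, connected graph on the node set $\mathcal{N}=\{1,\dots,N\}$, where $\mathcal{N}_i\subset\mathcal{N}$ denotes the set of neighbors of node $i$. Let $\mathcal{L}$ be the Laplacian matrix of this graph and let $\lambda_2(\mathcal{L})$ be its second smallest eigenvalue (the algebraic connectivity). Let $z_1,\dots,z_N\in\mathbb{R}$ be given numbers and $s_1,\dots,s_N\in\{0,1\}$ given indicators with $s_i=1$ for at least one $i$. Consider the system $$\dot{x}_i = s_i\,\mathrm{sgn}(z_i - x_i) + \gamma \sum_{j \in \mathcal{N}_i} (x_j - x_i), \qquad i \in \mathcal{N},$$ with $x_i\in\mathbb{R}$ and a design parameter $\gamma>0$. Then for each $\gamma>0$, the (Filippov) solution from any initial condition $x_i(0)\in\mathbb{R}$, $i\in\mathcal{N}$, exists for all $t\ge 0$ and satisfies $$\limsup_{t \to \infty} \|x_i(t)\|_{\mathcal{M}_{\mathcal{Z}}^{\mathcal{S}}} \le \frac{2\sqrt{N}}{\gamma\lambda_2(\mathcal{L})}, \qquad \forall i \in \mathcal{N}.$$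
   Context: The adjacency matrix $\mathcal{A}=[\alpha_{ij}]$ of the graph has entries $\alpha_{ij}\in\{0,1\}$ ($\alpha_{ij}=1$ iff $j\in\mathcal{N}_i$), and $\mathcal{L}=\mathcal{D}-\mathcal{A}$ with $\mathcal{D}$ the diagonal matrix of row sums of $\mathcal{A}$. The function $\mathrm{sgn}:\mathbb{R}\to\mathbb{R}$ is $\mathrm{sgn}(s)=s/|s|$ for $s\neq0$ and $\mathrm{sgn}(0)=0$; solutions of this discontinuous system are understood in the sense of Filippov. Let $S:=|\{i\in\mathcal{N}: s_i=1\}|$ and let $z_1^s\le z_2^s\le\cdots\le z_S^s$ be the elements of $\{z_i : s_i=1\}$ sorted in nondecreasing order (with multiplicity). The median set is $\mathcal{M}_{\mathcal{Z}}^{\mathcal{S}}=\{z^s_{(S+1)/2}\}$ if $S$ is odd and $\mathcal{M}_{\mathcal{Z}}^{\mathcal{S}}=[z^s_{S/2}, z^s_{S/2+1}]$ if $S$ is even. For a set $\Xi$, $\|x\|_\Xi:=\inf_{y\in\Xi}\|x-y\|$ denotes the distance from $x$ to $\Xi$. *)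

(* Defs.v *)
From HB Require Import structures.
From mathcomp Require Import all_boot all_order all_algebra.
From mathcomp Require Import all_classical all_reals all_analysis.
Set Implicit Arguments. Unset Strict Implicit. Unset Printing Implicit Defensive.
Import Order.TTheory GRing.Theory Num.Theory.
Import numFieldNormedType.Exports.
Local Open Scope classical_set_scope.
Local Open Scope ring_scope.

Section Defs.
Variable R : realType.

Definition sgn (r : R) : R := if r == 0 then 0 else r / `|r|.

Definition adjacency_mx (N : nat) (e : rel 'I_N) : 'M[R]_N :=
  \matrix_(i, j) (e i j)%:R.

Definition laplacian (N : nat) (e : rel 'I_N) : 'M[R]_N :=
  \matrix_(i, j) ((i == j)%:R * (\sum_k adjacency_mx e i k))
  - adjacency_mx e.

Definition median_field (N : nat) (e : rel 'I_N) (z : 'I_N -> R)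
  (s : 'I_N -> bool) (gamma : R) (x : 'rV[R]_N) : 'rV[R]_N :=
  \row_i ((s i)%:R * sgn (z i - x 0 i)
          + gamma * \sum_(j | e i j) (x 0 j - x 0 i)).

Definition nullN (N : nat) (S : set 'rV[R]_N) : Prop :=
  forall eps : R, 0 < eps -> exists a b : nat -> 'rV[R]_N,
    (forall k i, a k 0 i <= b k 0 i) /\
    (S `<=` \bigcup_k [set y | forall i, a k 0 i <= y 0 i <= b k 0 i]) /\
    (forall n, \sum_(k < n) \prod_(i < N) (b k 0 i - a k 0 i) < eps).

Definition convex_hull (N : nat) (A : set 'rV[R]_N) : set 'rV[R]_N :=
  [set y | exists (n : nat) (w : 'I_n -> R) (p : 'I_n -> 'rV[R]_N),
     (forall k, 0 <= w k) /\ \sum_k w k = 1 /\ (forall k, A (p k)) /\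
     y = \sum_k w k *: p k].

Definition filippov_map (N : nat) (f : 'rV[R]_N -> 'rV[R]_N) (x : 'rV[R]_N)
  : set 'rV[R]_N :=
  [set v | forall delta : R, 0 < delta -> forall S : set 'rV[R]_N, nullN S ->
     closure (convex_hull (f @` (ball x delta `\` S))) v].

Definition abs_continuous_on (N : nat) (f : R -> 'rV[R]_N) (a b : R) : Prop :=
  forall eps : R, 0 < eps -> exists2 delta : R, 0 < delta &
    forall (n : nat) (c d : nat -> R),
      (forall k, (k < n)%N -> a <= c k /\ c k <= d k /\ d k <= b) ->
      (forall k, (k.+1 < n)%N -> d k <= c k.+1) ->
      \sum_(k < n) (d k - c k) < delta ->
      \sum_(k < n) `|f (d k) - f (c k)| < eps.

Definition filippov_solution (N : nat) (f : 'rV[R]_N -> 'rV[R]_N)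
  (x : R -> 'rV[R]_N) : Prop :=
  (forall T : R, 0 <= T -> abs_continuous_on x 0 T) /\
  {ae (@lebesgue_measure R), forall t : R, 0 <= t ->
     derivable x t 1 /\ filippov_map f (x t) (derive1 x t)}.

Definition median_set (N : nat) (z : 'I_N -> R) (s : 'I_N -> bool) : set R :=
  let zs := sort <=%R [seq z i | i <- enum 'I_N & s i] in
  let S := size zs in
  if odd S then [set zs`_(S./2)]
  else [set y | zs`_(S./2).-1 <= y <= zs`_(S./2)].

Definition dist_set (x : R) (Xi : set R) : R := inf [set `|x - y| | y in Xi].

End Defs.

(* Main.v *)
(** Filippov's set at [x] is the box of all [v] with
    [v_i = gamma (sum_j (x_j - x_i)) + s_i sigma_i], where [|sigma_i| <= 1] and
    [sigma_i = sgn (z_i - x_i)] off the surface [x_i = z_i].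

    Existence: the field is monotone, so explicit Euler polygons whose steps are
    refined by factors of 4 form a uniformly Cauchy sequence.  The limit is
    locally Lipschitz and its increments near [t] lie in the box at [x(t)].
    Where the box is degenerate in coordinate [i] this forces [x_i] to be
    differentiable at [t]; otherwise [x_i(t) = z_i], and at a density point of
    the closed set [x_i = z_i] the derivative of [x_i] is 0.

    Asymptotics: with [r = sqrt N / (gamma lambda2)], the spread
    [sum_i (x_i - mean x)^2] decreases at a definite rate as long as it exceeds
    [(r + eps)^2], by Cauchy-Schwarz and the spectral gap.  Once it is trapped
    below this level, a mean more than [r + eps] above the median set puts every
    [x_i] above more than half of the active [z_i], so that the mean decreases;
    symmetrically from below.  The two errors add up to [2 (r + eps)]. *)

Require Import Defs.
From HB Require Import structures.
From mathcomp Require Import all_boot all_order all_algebra.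
From mathcomp Require Import all_classical all_reals all_analysis.
From mathcomp Require Import measurable_realfun zify ring lra.
Set Implicit Arguments. Unset Strict Implicit. Unset Printing Implicit Defensive.
Import Order.TTheory GRing.Theory Num.Theory.
Import numFieldNormedType.Exports.
Local Open Scope classical_set_scope.
Local Open Scope ring_scope.

(** Several obstacles shape the proof. [filippov_map] discards arbitrary null sets, so filling the
    whole box requires field values at points that avoid a given null set and still realise every
    pattern of signs; hence the proof that a box of positive volume is not null. The eigenvalue
    [lambda2] is an entry of a sorted list of roots counted with algebraic multiplicity. Rather than
    diagonalising the Laplacian, the proof excludes a double root 0 by a determinant identity and
    shows that the Rayleigh minimum over sum-zero vectors is a positive root. A solution obeys its
    inclusion only almost everywhere, so a bound on the derivative of a Lyapunov function yields
    decrease only through absolute continuity. The field is discontinuous, so refining a step need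
    not change the Euler increments by little; the error is instead controlled in the Euclidean
    norm, where monotonicity gives the main term a sign. For a single node [lambda2] is the default
    value 0 and, as the inverse of 0 is 0, the claimed bound is 0; this agrees with a spread that
    vanishes identically. *)

Lemma continuous_sum (R : realType) (T : topologicalType) (I : Type)
    (r : seq I) (P : pred I) (F : I -> T -> R) :
  (forall i, continuous (F i)) ->
  continuous (fun y => \sum_(i <- r | P i) F i y).
Proof.
move=> Fc; apply: continuous_big => [|i _]; last exact: Fc.
exact: add_continuous.
Qed.

(** * Laplacian and spectral gap *)

Section Laplacian.
Variables (R : realType) (N : nat) (e : rel 'I_N).
Hypotheses (e_sym : symmetric e) (e_conn : forall i j, connect e i j).
Implicit Types y u w : 'rV[R]_N.

Definition lap y (i : 'I_N) : R := \sum_(j | e i j) (y 0 j - y 0 i).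

(** On row vectors [lap] is minus the Laplacian, so this is the quadratic form of
    [laplacian R e]. *)
Definition dirichlet y : R := - \sum_i y 0 i * lap y i.

Lemma mulmx_laplacian y i : (y *m laplacian R e) 0 i = - lap y i.
Proof.
rewrite /laplacian mulmxBr mxE [X in X + _]mxE.
rewrite (bigD1 i)//= big1 ?addr0; last first.
  by move=> j ji; rewrite !mxE (negbTE ji) mul0r mulr0.
rewrite mxE eqxx mul1r mxE mxE /lap sumrB opprB.
congr (_ - _).
  rewrite mulr_sumr [RHS]big_mkcond; apply: eq_bigr => j _.
  by rewrite mxE; case: (e i j); rewrite ?mulr1 ?mulr0.
rewrite [RHS]big_mkcond; apply: eq_bigr => j _.
by rewrite mxE e_sym; case: (e i j); rewrite ?mulr1 ?mulr0.
Qed.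

(** Summation by parts: exchanging the two end points of each edge gives a second expression for the
    left side, and adding the two produces the product of differences. *)
Lemma sum_mul_lapE y w :
  \sum_i w 0 i * lap y i =
  - (\sum_i \sum_(j | e i j) (w 0 i - w 0 j) * (y 0 i - y 0 j)) / 2.
Proof.
set A := \sum_i w 0 i * lap y i; set B := \sum_i _.
suff : B = - (A + A) by move=> ->; field.
have AE : A = \sum_i \sum_(j | e i j) w 0 j * (y 0 i - y 0 j).
  rewrite (exchange_big_dep xpredT)//=; apply: eq_bigr => i _.
  by rewrite /lap mulr_sumr; apply: eq_bigl => j; rewrite e_sym.
rewrite opprD -[in - A]/(A) {2}AE -!sumrN -big_split /=; apply: eq_bigr => i _.
rewrite /lap mulr_sumr -!sumrN -big_split /=; apply: eq_bigr => j _.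
by ring.
Qed.

Lemma dirichletE y :
  dirichlet y = (\sum_i \sum_(j | e i j) (y 0 i - y 0 j) ^+ 2) / 2.
Proof. by rewrite /dirichlet sum_mul_lapE mulNr opprK. Qed.

Lemma sum_lap y : \sum_i lap y i = 0.
Proof.
have := sum_mul_lapE y (const_mx 1).
under eq_bigr do rewrite mxE mul1r.
move=> ->; rewrite big1 ?oppr0 ?mul0r// => i _; rewrite big1// => j _.
by rewrite !mxE subrr mul0r.
Qed.

Lemma sum_mul_lapC y w :
  \sum_i w 0 i * lap y i = \sum_i y 0 i * lap w i.
Proof.
rewrite !sum_mul_lapE; congr (- _ / _); apply: eq_bigr => i _.
by apply: eq_bigr => j _; rewrite mulrC.
Qed.

Lemma dirichlet_ge0 y : 0 <= dirichlet y.
Proof.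
by rewrite dirichletE divr_ge0// sumr_ge0// => i _; rewrite sumr_ge0// => j _;
  rewrite sqr_ge0.
Qed.

Lemma dirichlet_eq0 y : dirichlet y = 0 -> forall i j, y 0 i = y 0 j.
Proof.
rewrite dirichletE => /eqP; rewrite mulf_eq0 invr_eq0 pnatr_eq0 orbF.
rewrite psumr_eq0; last by move=> i _; rewrite sumr_ge0// => j _; rewrite sqr_ge0.
move=> /allP h i j.
have eyy k l : e k l -> y 0 k = y 0 l.
  move=> ekl; have /= := h k (mem_index_enum _).
  rewrite psumr_eq0; last by move=> ? _; rewrite sqr_ge0.
  move=> /allP /(_ l (mem_index_enum _)); rewrite ekl/= sqrf_eq0 subr_eq0.
  by move/eqP.
have /connectP[p pe ->] := e_conn i j.
elim: p i pe => //= k p IH i /andP[eik /IH <-]; exact: eyy.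
Qed.

Lemma dirichletD y w t : dirichlet (y + t *: w) =
  dirichlet y - 2 * t * (\sum_i w 0 i * lap y i) + t ^+ 2 * dirichlet w.
Proof.
have lapD i : lap (y + t *: w) i = lap y i + t * lap w i.
  rewrite /lap mulr_sumr -big_split/=; apply: eq_bigr => j _.
  by rewrite !mxE; ring.
rewrite /dirichlet.
under eq_bigr do rewrite lapD 2!mxE mulrDr !mulrDl.
rewrite !big_split/=.
have -> : \sum_i y 0 i * (t * lap w i) = t * \sum_i w 0 i * lap y i.
  by rewrite sum_mul_lapC mulr_sumr; apply: eq_bigr => i _; ring.
have -> : \sum_i t * w 0 i * lap y i = t * \sum_i w 0 i * lap y i.
  by rewrite mulr_sumr; apply: eq_bigr => i _; ring.
have -> : \sum_i t * w 0 i * (t * lap w i) = t ^+ 2 * \sum_i w 0 i * lap w i.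
  by rewrite mulr_sumr; apply: eq_bigr => i _; ring.
by ring.
Qed.

Definition sqnorm y : R := \sum_i y 0 i ^+ 2.

Lemma sqnorm_eq0 y : sqnorm y = 0 -> y = 0.
Proof.
move=> /eqP; rewrite psumr_eq0; last by move=> i _; rewrite sqr_ge0.
move=> /allP h; apply/rowP => i; rewrite mxE.
by have /= := h i (mem_index_enum _); rewrite sqrf_eq0 => /eqP.
Qed.

Lemma sqnormD y w t : sqnorm (y + t *: w) =
  sqnorm y + 2 * t * (\sum_i w 0 i * y 0 i) + t ^+ 2 * sqnorm w.
Proof.
rewrite /sqnorm !mulr_sumr -!big_split/=; apply: eq_bigr => i _.
by rewrite !mxE; ring.
Qed.

Lemma sqnormZ t y : sqnorm (t *: y) = t ^+ 2 * sqnorm y.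
Proof. by rewrite /sqnorm mulr_sumr; apply: eq_bigr => i _; rewrite mxE; ring. Qed.

Lemma dirichletZ t y : dirichlet (t *: y) = t ^+ 2 * dirichlet y.
Proof.
rewrite !dirichletE mulrA; congr (_ / _); rewrite mulr_sumr.
apply: eq_bigr => i _; rewrite mulr_sumr; apply: eq_bigr => j _.
by rewrite !mxE; ring.
Qed.

(** The first-order condition at a minimum. The test value of [t] makes the expression a negative
    multiple of [a ^+ 2]. *)
Lemma quad_ge0_lin0 (a b : R) : (forall t, 0 <= t * a + t ^+ 2 * b) -> a = 0.
Proof.
move=> h; apply/eqP/contraT => a0.
have b1 : 0 < `|b| + 1 by rewrite ltr_wpDl.
have := h (- a / (`|b| + 1)).
have -> : - a / (`|b| + 1) * a + (- a / (`|b| + 1)) ^+ 2 * b =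
   (a ^+ 2 / (`|b| + 1) ^+ 2) * (b - `|b| - 1) by field; rewrite gt_eqF.
rewrite pmulr_rge0; last by rewrite divr_gt0// exprn_even_gt0//= gt_eqF.
have := ler_norm b; lra.
Qed.

Lemma continuous_entry i : continuous (fun y : 'rV[R]_N => y 0 i).
Proof. by move=> y; exact: (@coord_continuous _ _ _ 0 i). Qed.

Lemma continuous_sqnorm : continuous sqnorm.
Proof.
apply: continuous_sum => i y; apply: (@continuousM _ _ (fun y => y 0 i));
  exact: continuous_entry.
Qed.

Lemma continuous_dirichlet : continuous dirichlet.
Proof.
move=> y; apply: continuousN; move: y; apply: continuous_sum => i y.
apply: (@continuousM _ _ (fun y => y 0 i)); first exact: continuous_entry.
move: y; apply: continuous_sum => j y.
apply: (@continuousB _ _ _ (fun y => y 0 j)); exact: continuous_entry.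
Qed.

Lemma sqr_entry_le_sqnorm y i : y 0 i ^+ 2 <= sqnorm y.
Proof.
by rewrite /sqnorm (bigD1 i)//= lerDl sumr_ge0// => j _; rewrite sqr_ge0.
Qed.

(** The unit sphere of the sum-zero hyperplane is compact, and nonempty once there are two nodes;
    homogeneity of degree 2 carries the minimum over to all sum-zero vectors. *)
Lemma rayleigh_minimizer : (1 < N)%N -> exists u : 'rV[R]_N,
  [/\ sqnorm u = 1, \sum_i u 0 i = 0 &
   forall y, \sum_i y 0 i = 0 -> dirichlet u * sqnorm y <= dirichlet y].
Proof.
move=> N1.
pose A := [set y : 'rV[R]_N | sqnorm y = 1 /\ \sum_i y 0 i = 0].
have [|||u uA umin] := @compact_EVT_min _ R dirichlet A.
- pose i0 := Ordinal (ltnW N1); pose i1 := Ordinal N1.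
  pose c : R := Num.sqrt (2^-1).
  have ne : i1 != i0 by [].
  exists (c *: (delta_mx 0 i0 - delta_mx 0 i1)); split => /=.
    rewrite sqnormZ sqr_sqrtr ?invr_ge0// /sqnorm (bigD1 i0)//= (bigD1 i1)//=.
    rewrite big1 ?addr0.
      by rewrite !mxE/= ; field.
    by move=> i /andP[/negbTE h0 /negbTE h1]; rewrite !mxE h0 h1/= subr0 expr0n.
  rewrite (bigD1 i0)//= (bigD1 i1)//= big1 ?addr0.
    by rewrite !mxE/=; ring.
  by move=> i /andP[/negbTE h0 /negbTE h1]; rewrite !mxE h0 h1/= subr0 mulr0.
- apply: bounded_closed_compact.
    exists 1; split => // M M1 y [y1 _].
    rewrite /Num.Def.normr/= mx_normrE; apply: bigmax_le; first by lra.
    move=> [i j] _ /=; rewrite (ord1 i).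
    have := sqr_entry_le_sqnorm y j; rewrite y1 -{1}real_normK ?num_real//.
    move=> h; have : `|y 0 j| <= 1 by rewrite -(@expr_le1 _ 2).
    lra.
  apply: closedI.
    apply: (@preimage_closed _ _ sqnorm [set 1]) => [y _|].
      exact: continuous_sqnorm.
    exact: closed_eq.
  apply: (@preimage_closed _ _ (fun y : 'rV[R]_N => \sum_i y 0 i) [set 0]) => [y _|].
    by apply: continuous_sum => i; exact: continuous_entry.
  exact: closed_eq.
- by apply: continuous_subspaceT; exact: continuous_dirichlet.
rewrite inE in uA; case: uA => u1 u0.
exists u; split=> // y y0.
have [->|ynz] := eqVneq y 0.
  have -> : sqnorm (0 : 'rV[R]_N) = 0.
    by rewrite /sqnorm big1// => i _; rewrite mxE expr0n.
  by rewrite mulr0; exact: dirichlet_ge0.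
have yp : 0 < sqnorm y.
  rewrite lt_def; apply/andP; split.
    by apply: contra_neq ynz => /sqnorm_eq0.
  by apply: sumr_ge0 => i _; rewrite sqr_ge0.
set c := Num.sqrt ((sqnorm y)^-1).
have c2 : c ^+ 2 = (sqnorm y)^-1 by rewrite sqr_sqrtr// invr_ge0 ltW.
have : dirichlet u <= dirichlet (c *: y).
  apply: umin; rewrite inE; split => /=.
    by rewrite sqnormZ c2 mulVf// gt_eqF.
  by under eq_bigr do rewrite mxE; rewrite -mulr_sumr y0 mulr0.
by rewrite dirichletZ c2 mulrC ler_pdivlMr.
Qed.

(** The first variation shows that the residual [lap u + mu u] is orthogonal to all sum-zero
    vectors. The residual has sum zero itself, so it is orthogonal to itself and vanishes. *)
Lemma rayleigh_minimizer_eigen u :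
  sqnorm u = 1 -> \sum_i u 0 i = 0 ->
  (forall y, \sum_i y 0 i = 0 -> dirichlet u * sqnorm y <= dirichlet y) ->
  u *m laplacian R e = dirichlet u *: u.
Proof.
move=> u1 u0 umin; set mu := dirichlet u.
have orth w : \sum_i w 0 i = 0 -> \sum_i w 0 i * (lap u i + mu * u 0 i) = 0.
  move=> w0.
  suff : - 2 * \sum_i w 0 i * (lap u i + mu * u 0 i) = 0 by lra.
  apply: (@quad_ge0_lin0 _ (dirichlet w - mu * sqnorm w)) => t.
  have tw0 : \sum_i (u + t *: w) 0 i = 0.
    under eq_bigr do rewrite 2!mxE.
    by rewrite big_split/= -mulr_sumr u0 w0; ring.
  have := umin _ tw0; rewrite dirichletD sqnormD u1 -/mu.
  have -> : \sum_i w 0 i * (lap u i + mu * u 0 i) =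
    \sum_i w 0 i * lap u i + mu * \sum_i w 0 i * u 0 i.
    by rewrite mulr_sumr -big_split/=; apply: eq_bigr => i _; ring.
  by rewrite -subr_ge0; congr (0 <= _); ring.
pose w : 'rV[R]_N := \row_i (lap u i + mu * u 0 i).
have w0 : \sum_i w 0 i = 0.
  under eq_bigr do rewrite mxE.
  by rewrite big_split/= sum_lap -mulr_sumr u0; ring.
have : sqnorm w = 0.
  rewrite -(orth _ w0); apply: eq_bigr => i _; rewrite !mxE; ring.
move=> /sqnorm_eq0 /rowP wE; apply/rowP => i.
by rewrite mulmx_laplacian mxE; have := wE i; rewrite !mxE -/mu; lra.
Qed.

End Laplacian.

(** * Characteristic polynomials and rank-one perturbations *)

Section CharPolyRankOne.
Variables (F : fieldType) (n : nat).

(** The determinant of the bordered matrix [M] is computed by eliminating either of its diagonal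
    blocks. The factor ['X] on the left avoids the exponent [n - 1]. *)
Lemma char_poly_rank_one (c : 'cV[F]_n) (r : 'rV[F]_n) :
  char_poly (c *m r) * 'X = ('X - ((r *m c) 0 0)%:P) * 'X^n.
Proof.
pose cP : 'cV[{poly F}]_n := map_mx polyC c.
pose rP : 'rV[{poly F}]_n := map_mx polyC r.
pose M : 'M[{poly F}]_(1 + n) := block_mx 1%:M rP cP 'X%:M.
have detM1 : \det M = char_poly (c *m r).
  have -> : M = block_mx 1%:M 0 cP 1%:M *m
                block_mx 1%:M rP 0 (char_poly_mx (c *m r)).
    rewrite mulmx_block !mul1mx !mul0mx !mulmx1 !addr0.
    by rewrite /char_poly_mx map_mxM addrC subrK.
  by rewrite det_mulmx det_lblock det_ublock !det1 !mul1r.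
have detM2 : \det M * 'X = ('X - ((r *m c) 0 0)%:P) * 'X^n.
  have /(congr1 determinant) : M *m block_mx 'X%:M 0 (- cP) 1%:M =
      block_mx ('X%:M - rP *m cP) rP 0 'X%:M.
    rewrite mulmx_block !mul1mx !mulmx0 !mulmx1 !add0r !mulmxN.
    by rewrite scalar_mxC subrr.
  rewrite det_mulmx det_lblock det_ublock det1 mulr1 !det_scalar expr1 => ->.
  congr (_ * _); rewrite [_ - _]mx11_scalar det_scalar1 -map_mxM.
  by rewrite !mxE mulr1n.
by rewrite -detM1.
Qed.

(* [(X - A) (X - c r) = X (X - A - c r)] when [A c = 0]. *)
Lemma char_poly_mul_eq0 (A : 'M[F]_n) (c : 'cV[F]_n) (r : 'rV[F]_n) :
  A *m c = 0 ->
  char_poly A * ('X - ((r *m c) 0 0)%:P) = 'X * char_poly (A + c *m r).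
Proof.
move=> Ac0.
have prodE : char_poly_mx A *m char_poly_mx (c *m r) =
             'X%:M *m char_poly_mx (A + c *m r).
  rewrite /char_poly_mx mulmxBl !mulmxBr -map_mxM mulmxA Ac0 mul0mx map_mx0.
  by rewrite subr0 map_mxD mulmxDr opprD addrA (scalar_mxC _ (map_mx polyC A)) addrAC.
have := congr1 determinant prodE; rewrite !det_mulmx det_scalar.
rewrite -[\det (char_poly_mx A)]/(char_poly A).
rewrite -[\det (char_poly_mx (c *m r))]/(char_poly (c *m r)).
rewrite -[\det (char_poly_mx (A + c *m r))]/(char_poly (A + c *m r)) => h.
apply: (mulIf (monic_neq0 (monicXn F n))).
by rewrite -mulrA -char_poly_rank_one mulrA h; ring.
Qed.

End CharPolyRankOne.

Section SpectralGap.
Variables (R : realType) (N : nat) (e : rel 'I_N).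
Hypotheses (e_sym : symmetric e) (e_conn : forall i j, connect e i j).

Lemma laplacian_eigenvalue_ge0 a :
  root (char_poly (laplacian R e)) a -> 0 <= a.
Proof.
rewrite -eigenvalue_root_char => /eigenvalueP[u uL u0].
have up : 0 < sqnorm u.
  rewrite lt_def sumr_ge0 ?andbT => [|i _]; last by rewrite sqr_ge0.
  by apply: contra_neq u0 => /sqnorm_eq0.
rewrite -(pmulr_lge0 _ up); have -> : a * sqnorm u = dirichlet e u.
  rewrite /dirichlet mulr_sumr -sumrN; apply: eq_bigr => i _.
  have /rowP /(_ i) := uL; rewrite (mulmx_laplacian e_sym) mxE => h.
  by rewrite -mulrN h; ring.
exact: dirichlet_ge0.
Qed.

Lemma laplacian_mul_ones : laplacian R e *m const_mx 1 = 0 :> 'cV_N.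
Proof.
apply/colP => i; rewrite [RHS]mxE mxE.
under eq_bigr do rewrite [const_mx _ _ _]mxE mulr1.
rewrite /laplacian.
under eq_bigr do rewrite !mxE.
rewrite sumrB -mulr_suml [X in X * _](_ : _ = 1) ?mul1r.
  by rewrite -sumrB big1// => j _; rewrite mxE subrr.
rewrite (bigD1 i)//= eqxx big1 ?addr0// => j.
by rewrite eq_sym => /negbTE ->.
Qed.

(** Pairing a kernel vector with itself gives a vanishing sum of its Dirichlet form and the square
    of its entry sum; it is then constant by connectedness, with sum 0. *)
Lemma laplacian_add_ones_root0 : (0 < N)%N ->
  ~~ root (char_poly (laplacian R e + const_mx 1 *m (const_mx 1 : 'rV_N))) 0.
Proof.
move=> N0; rewrite -eigenvalue_root_char.
apply/negP => /eigenvalueP[u uL u0].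
have uE i : - lap e u i + \sum_k u 0 k = 0.
  have /rowP /(_ i) := uL.
  rewrite scale0r mulmxDr mulmxA mxE (mulmx_laplacian e_sym) [RHS]mxE.
  apply: etrans; congr (_ + _); rewrite mxE big_ord_recl big_ord0 addr0.
  rewrite mxE [const_mx _ _ _]mxE mulr1.
  by apply: eq_bigr => k _; rewrite mxE mulr1.
set S := \sum_k u 0 k in uE.
have : dirichlet e u + S ^+ 2 = 0.
  rewrite /dirichlet expr2 {1}/S mulr_suml -sumrN -big_split big1//= => i _.
  by have /(congr1 (fun t => u 0 i * t)) := uE i; rewrite mulr0 => <-; ring.
move=> h; have D0 := dirichlet_ge0 e_sym u; have S0 := sqr_ge0 S.
have /(dirichlet_eq0 e_sym e_conn) uc : dirichlet e u = 0 by lra.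
have /eqP : S ^+ 2 = 0 by lra.
rewrite sqrf_eq0 => /eqP S1; case/eqP: u0; apply/rowP => i.
move: S1; rewrite /S (eq_bigr (fun=> u 0 i)) => [|j _]; last exact: uc.
rewrite sumr_const card_ord mxE => /eqP; rewrite mulrn_eq0 => /orP[|/eqP//].
by rewrite eqn0Ngt N0.
Qed.

(** For the inequality it suffices that the Rayleigh minimum is a root other than the first of the
    sorted list. Connectedness makes it positive, while 0 is a root as well, so its index is at
    least 1. *)
Lemma laplacian_gap (ev : seq R) :
  char_poly (laplacian R e) = \prod_(a <- ev) ('X - a%:P) ->
  sorted <=%R ev -> (1 < N)%N ->
  0 < ev`_1 /\ forall y : 'rV[R]_N, \sum_i y 0 i = 0 ->
    ev`_1 * sqnorm y <= dirichlet e y.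
Proof.
move=> evE ev_s N1.
have rootE a : root (char_poly (laplacian R e)) a = (a \in ev).
  by rewrite evE root_prod_XsubC.
have sz : size ev = N.
  by have := size_char_poly (laplacian R e); rewrite evE size_prod_XsubC => -[].
have ev1 : ev`_1 \in ev by rewrite mem_nth// sz.
have ev0 : ev`_0 \in ev by rewrite mem_nth// sz (ltnW N1).
have ev_mono i j : (i <= j)%N -> (j < size ev)%N -> ev`_i <= ev`_j.
  move=> ij jsz; apply: (sorted_leq_nth le_trans le_refl 0 ev_s) => //.
  by rewrite inE (leq_ltn_trans ij).
have le01 : ev`_0 <= ev`_1 by rewrite ev_mono// sz.
(* A double root 0 would make [0] a root of [char_poly (L + J)], [J] the
   all-ones matrix, but [L + J] is positive definite. *)
have p1 : 0 < ev`_1.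
  rewrite lt_def; have := laplacian_eigenvalue_ge0.
  move=> ge0; rewrite ge0 ?rootE// andbT; apply/eqP => e1.
  have e0 : ev`_0 = 0.
    by apply/le_anti; rewrite (le_trans le01) ?e1// ge0 ?rootE.
  have [q qE] : exists q, char_poly (laplacian R e) = 'X * ('X * q).
    case: (ev) sz e0 e1 evE => [|a [|b ev']] /=; try by move=> N0; rewrite -N0 in N1.
    move=> _ -> -> ->; exists (\prod_(c <- ev') ('X - c%:P)).
    by rewrite !big_cons !subr0.
  have := char_poly_mul_eq0 (const_mx 1) laplacian_mul_ones.
  rewrite qE -mulrA => /(mulfI (monic_neq0 (monicX R))) h.
  have := laplacian_add_ones_root0 (ltnW N1); rewrite -h.
  by rewrite !rootM rootX eqxx.
split=> // y y0.
have [u [u1 u0 umin]] := rayleigh_minimizer R e_sym N1.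
suff le1 : ev`_1 <= dirichlet e u.
  apply: le_trans (umin _ y0); apply: ler_wpM2r => //.
  by apply: sumr_ge0 => i _; rewrite sqr_ge0.
have uev : dirichlet e u \in ev.
  rewrite -rootE -eigenvalue_root_char; apply/eigenvalueP; exists u.
    exact: rayleigh_minimizer_eigen.
  apply/eqP => uz; move: u1; rewrite uz /sqnorm big1 => [/esym/eqP|i _].
    by rewrite oner_eq0.
  by rewrite mxE expr0n.
have up : 0 < dirichlet e u.
  rewrite lt_def dirichlet_ge0// andbT; apply/eqP => /(dirichlet_eq0 e_sym e_conn) uc.
  pose i0 : 'I_N := Ordinal (ltnW N1).
  have ui i : u 0 i = 0.
    rewrite (uc i i0); move: u0.
    rewrite (eq_bigr (fun=> u 0 i0)) => [|j _]; last exact: uc.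
    rewrite sumr_const card_ord => /eqP; rewrite mulrn_eq0 => /orP[|/eqP//].
    by rewrite eqn0Ngt (ltnW N1).
  move: u1; rewrite /sqnorm big1 => [/esym/eqP|i _]; first by rewrite oner_eq0.
  by rewrite ui expr0n.
have zev : 0 \in ev.
  rewrite -rootE -eigenvalue_root_char; apply/eigenvalueP; exists (const_mx 1).
    rewrite scale0r; apply/rowP => i.
    rewrite (mulmx_laplacian e_sym) mxE /lap big1 ?oppr0// => j _.
    by rewrite !mxE subrr.
  apply/eqP => /rowP /(_ (Ordinal (ltnW N1))); rewrite !mxE => /eqP.
  by rewrite oner_eq0.
have ui : (index (dirichlet e u) ev < size ev)%N by rewrite index_mem.
rewrite -[leRHS](nth_index 0 uev); apply: (ev_mono _ _) => //.
rewrite lt0n; apply/eqP => i0.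
have dE : dirichlet e u = ev`_0 by rewrite -i0 nth_index.
have : ev`_0 <= 0.
  by rewrite -[leRHS](nth_index 0 zev) ev_mono// index_mem.
by rewrite -dE leNgt up.
Qed.

End SpectralGap.

(** * Absolutely continuous functions *)

Section AbsolutelyContinuousMonotone.
Variable R : realType.
Implicit Types (g : R -> R) (a b t u v : R).
Local Notation mu := (@lebesgue_measure R).

(** The step leads from [u] on the left of [t] to [v] on its right, so that a supremum not yet known
    to satisfy [P] is reached and passed at once. *)
Lemma real_induction (P : R -> Prop) a b : a <= b -> P a ->
  (forall t, a <= t <= b -> exists2 delta, 0 < delta &
     forall u v, a <= u -> t - delta < u -> u <= t -> t <= v -> v < t + delta ->
       v <= b -> P u -> P v) ->
  P b.
Proof.
move=> ab Pa step.
pose S := [set t | a <= t <= b /\ P t].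
have Sa : S a by split=> //; rewrite lexx ab.
have supS : has_sup S.
  by split; [exists a | exists b => t [/andP[_ tb] _]].
set s := sup S.
have as_ : a <= s by apply: ub_le_sup => //; case: supS.
have sb : s <= b by apply: ge_sup => [|t [/andP[_ tb] _]//]; exists a.
have [|delta d0 hs] := step s; first by rewrite as_ sb.
have [u [/andP[au ub] Pu] su] := sup_adherent d0 supS.
have us : u <= s by apply: ub_le_sup; [case: supS|split=> //; rewrite au].
pose v := Num.min b (s + delta / 2).
have Pv : P v.
  apply: (hs u) => //.
  - by rewrite le_min sb/=; lra.
  - by rewrite gt_min; apply/orP; right; lra.
  - by rewrite ge_min lexx.
have vs : v <= s.
  apply: ub_le_sup; [by case: supS|split=> //].
  by rewrite le_min ab ge_min lexx/=; lra.
have vb : v = b.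
  by move: vs; rewrite /v; case: (leP b) => // _; lra.
by rewrite -vb.
Qed.

Definition abs_cont g a b : Prop :=
  forall eps : R, 0 < eps -> exists2 delta : R, 0 < delta &
    forall (n : nat) (c d : nat -> R),
      (forall k, (k < n)%N -> a <= c k /\ c k <= d k /\ d k <= b) ->
      (forall k, (k.+1 < n)%N -> d k <= c k.+1) ->
      \sum_(k < n) (d k - c k) < delta ->
      \sum_(k < n) `|g (d k) - g (c k)| < eps.

(** The interval has to straddle [t]: splitting it there leaves two difference quotients based at
    [t], the only ones that the derivative at [t] controls. *)
Lemma derive1_local_bound g t (k eps : R) : derivable g t 1 -> derive1 g t <= k ->
  0 < eps -> exists2 delta, 0 < delta &
    forall u v, t - delta < u -> u <= t -> t <= v -> v < t + delta ->
      g v - g u <= (k + eps) * (v - u).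
Proof.
rewrite derive1E => dg gk e0.
have /cvgrPdist_le /(_ _ e0) : h^-1 *: (g (h *: 1 + t) - g t) @[h --> 0^']
   --> 'D_1 g t by exact: dg.
rewrite /dnbhs /within/= => /nbhs_ballP[delta /= d0 hd]; exists delta => //.
have key h : `|h| < delta -> h != 0 -> `|(g (h + t) - g t) / h - 'D_1 g t| <= eps.
  move=> hl hn; have := hd h; rewrite /ball/= sub0r normrN => /(_ hl hn).
  by rewrite distrC /GRing.scale/= mulr1 mulrC.
move=> u v tu ut tv vt.
have gv : g v - g t <= (k + eps) * (v - t).
  have [->|vnt] := eqVneq v t; first by rewrite !subrr mulr0.
  have vt0 : 0 < v - t by rewrite subr_gt0 lt_def vnt.
  have := key (v - t); rewrite subrK => /(_ _ _)/ler_normlW.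
  rewrite gtr0_norm// subr_eq0 => /(_ _ vnt) h.
  rewrite -ler_pdivrMr//; have : v - t < delta by lra.
  move=> /h; lra.
have gu : g t - g u <= (k + eps) * (t - u).
  have [->|unt] := eqVneq u t; first by rewrite !subrr mulr0.
  have ut0 : 0 < t - u by rewrite subr_gt0 lt_def eq_sym unt.
  have := key (u - t); rewrite subrK => /(_ _ _)/ler_normlW.
  rewrite (_ : `|u - t| = - (u - t)) ?subr_eq0; last by rewrite ltr0_norm; lra.
  move=> /(_ _ unt) h.
  rewrite -ler_pdivrMr//; have : - (u - t) < delta by lra.
  move=> /h; have -> : (g u - g t) / (u - t) = (g t - g u) / (t - u).
    by rewrite -[u - t]opprB invrN mulrN -mulNr opprB.
  lra.
have -> : v - u = (v - t) + (t - u) by ring.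
by rewrite mulrDr; lra.
Qed.

Lemma negligible_open_cover (A : set R) (eps : R) : mu.-negligible A -> 0 < eps ->
  exists U : set R, [/\ open U, A `<=` U & (mu U < eps%:E)%E].
Proof.
move=> [B [mB B0 AB]] e0.
have [|U [oU BU UB]] := @lebesgue_regularity_outer R B eps mB _ e0.
  by rewrite -[X in (X < _)%E]/(mu B) B0.
exists U; split=> //; first exact: subset_trans BU.
apply: le_lt_trans UB.
have mU : measurable U by exact: open_measurable.
rewrite -[X in mu X](setDKU BU); apply: le_trans (measureU2 _ _ _) _ => //.
  exact: measurableD.
by rewrite [X in (_ + X)%E](_ : _ = 0%E) ?adde0//; exact: B0.
Qed.

(** A comparison principle obtained from straddling intervals and real induction, without
    integrating the derivative. The slope is relaxed by [eps] and a total error [2 * eps] is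
    allowed: one [eps] for the variation of [g] inside the exceptional open set, one for the slope
    lost there. *)
Lemma abs_cont_derive_le g a b (k : R) : a <= b -> abs_cont g a b ->
  {ae mu, forall t, a < t < b -> derivable g t 1 /\ derive1 g t <= k} ->
  g b - g a <= k * (b - a).
Proof.
move=> ab gac gae.
suff main (eps : R) : 0 < eps -> g b - g a <= (k + eps) * (b - a) + 2 * eps.
  apply/ler_addgt0Pr => eps e0.
  have c0 : 0 < b - a + 2 by lra.
  have := main (eps / (b - a + 2)) (divr_gt0 e0 c0).
  have -> : (k + eps / (b - a + 2)) * (b - a) + 2 * (eps / (b - a + 2)) =
    k * (b - a) + eps by field; rewrite gt_eqF.
  by [].
move=> e0.
have [delta d0 hd] := gac eps e0.
(* The first bound serves absolute continuity; the second makes [|k|] times the length of the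
   exceptional intervals at most [eps]. *)
pose del := Num.min delta (eps / (`|k| + 1)).
have k1 : 0 < `|k| + 1 by rewrite ltr_wpDl.
have del0 : 0 < del by rewrite lt_min d0 divr_gt0.
(* The end points join the exceptional set because real induction visits them, whereas the
   derivative is controlled only in the open interval. *)
have nE : mu.-negligible
    ([set t | ~ (a < t < b -> derivable g t 1 /\ derive1 g t <= k)]
      `|` ([set a] `|` [set b])).
  apply: negligibleU => //; apply: negligibleU.
    by exists [set a]; split => //; exact: lebesgue_measure_set1.
  by exists [set b]; split => //; exact: lebesgue_measure_set1.
have [U [oU EU muU]] := negligible_open_cover nE del0.
have mU : measurable U by exact: open_measurable.
(* The interval []a, t]] is half-open so that appending []u, v]] to []a, u]] is a disjoint union, on
   which the measure is additive. *)
pose cover t n (c d : nat -> R) :=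
  [/\ (forall k, (k < n)%N -> a <= c k /\ c k <= d k /\ d k <= t),
      (forall k, (k.+1 < n)%N -> d k <= c k.+1) &
      ((\sum_(k < n) (d k - c k))%:E <= mu (U `&` `]a, t]))%E].
(* The increment of [g] on [[a, t]] is controlled by the derivative, except on
   finitely many intervals inside the small open set [U]. *)
pose P t := exists n c d, cover t n c d /\
   g t - g a <= (k + eps) * (t - a) +
      \sum_(i < n) (`|g (d i) - g (c i)| + `|k| * (d i - c i)).
have : P b.
  apply: (real_induction ab).
    exists 0%N, (fun=> a), (fun=> a); split; last first.
      by rewrite big_ord0 !subrr mulr0 addr0.
    by split=> //; rewrite big_ord0.
  move=> t /andP[at_ tb].
  have [tU|tU] := pselect (U t).
    have /nbhs_ballP[r /= r0 rU] : nbhs t U by exact: open_nbhs_nbhs.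
    exists r => // u v au tu ut tv vt vb [n [c [d [[cd1 cd2 cd3] gu]]]].
    have uvU x : u <= x <= v -> U x.
      move=> /andP[ux xv]; apply: rU; rewrite /ball/= ltr_norml; lra.
    exists n.+1, (fun i => if (i < n)%N then c i else u),
       (fun i => if (i < n)%N then d i else v); split; last first.
      rewrite big_ord_recr/= ltnn.
      under eq_bigr do rewrite ltn_ord.
      have kk := ler_norm (- k); rewrite normrN in kk.
      have gg := ler_norm (g v - g u).
      (* For negative [k] the slope term decreases across the new interval; the added multiple of
         its length by [|k|] makes up for this. *)
      have : 0 <= (`|k| + k + eps) * (v - u) by rewrite mulr_ge0; lra.
      have := gu; set s := \sum_(i < n) _; lra.
    split.
    - move=> i _; case: ifPn => [/cd1|_]; last by repeat split=> //; lra.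
      by move=> [? [? ?]]; repeat split => //; lra.
    - move=> i; rewrite ltnS => i_n; rewrite i_n.
      case: ifPn => [|_]; first exact: cd2.
      by have [_ [_]] := cd1 _ i_n.
    - rewrite big_ord_recr/= ltnn.
      under eq_bigr do rewrite ltn_ord.
      have -> : U `&` `]a, v] = (U `&` `]a, u]) `|` (`]u, v]%classic).
        apply/seteqP; split=> x /=; rewrite !in_itv/=.
          move=> [Ux /andP[ax xv]]; case: (leP x u) => xu.
            by left; split=> //; rewrite ax.
          by right; rewrite xv.
        move=> [[Ux /andP[ax xu]]|/andP[ux xv]].
          by split=> //; rewrite ax/=; lra.
        by split; [apply: uvU; lra|lra].
      have itvm : measurable (`]u, v]%classic : set R) by [].
      rewrite measureU//; last 2 first.
        by apply: measurableI.
        apply/seteqP; split=> x //=; rewrite !in_itv/=.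
        by move=> [[_ /andP[_ xu]] /andP[]]; rewrite ltNge xu.
      rewrite EFinD leeD//.
      have muv : ((v - u)%:E <= mu `]u, v])%E.
        rewrite lebesgue_measure_itv/= lte_fin; case: ltP => [_|vu].
          by rewrite -EFinB.
        by rewrite lee_fin; lra.
      exact: muv.
  have tab : a < t < b.
    by rewrite !lt_def at_ tb !andbT; apply/andP; split; apply/eqP => tE;
      apply: tU; apply: EU; right; [left|right].
  have [dg gk] : derivable g t 1 /\ derive1 g t <= k.
    have [//|] := pselect (derivable g t 1 /\ derive1 g t <= k).
    by move=> h; case: tU; apply: EU; left => /= /(_ tab).
  have [r r0 hr] := derive1_local_bound dg gk e0.
  exists r => // u v au tu ut tv vt vb [n [c [d [[cd1 cd2 cd3] gu]]]].
  exists n, c, d; split; last first.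
    have := hr _ _ tu ut tv vt; have := gu; set s := \sum_(i < n) _; lra.
  split=> //.
    by move=> i /cd1[? [? ?]]; repeat split => //; lra.
  apply: le_trans cd3 _; apply: le_measure; rewrite ?inE; try exact: measurableI.
  apply: setIS => x /=; rewrite !in_itv/= => /andP[-> /=]; lra.
move=> [n [c [d [[cd1 cd2 cd3] gb]]]].
have sdel : \sum_(i < n) (d i - c i) < del.
  rewrite -lte_fin; apply: le_lt_trans cd3 _; apply: le_lt_trans muU.
  by apply: le_measure; rewrite ?inE//; exact: measurableI.
have s1 : \sum_(i < n) `|g (d i) - g (c i)| < eps.
  by apply: hd => //; apply: lt_le_trans sdel _; rewrite ge_min lexx.
have s2 : `|k| * \sum_(i < n) (d i - c i) <= eps.
  apply: (@le_trans _ _ (`|k| * (eps / (`|k| + 1)))).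
    apply: ler_wpM2l => //; apply/ltW/(lt_le_trans sdel).
    by rewrite ge_min lexx orbT.
  rewrite mulrCA ger_pMr// ler_pdivrMr// mul1r; lra.
move: gb; rewrite big_split/= -mulr_sumr; lra.
Qed.

End AbsolutelyContinuousMonotone.

(** * Trapping an absolutely continuous function below a level *)

Section Trap.
Variable R : realType.
Implicit Types (g : R -> R) (a b t u v : R).
Local Notation mu := (@lebesgue_measure R).

Lemma ae_sub (P Q : R -> Prop) : (forall t, P t -> Q t) ->
  {ae mu, forall t, P t} -> {ae mu, forall t, Q t}.
Proof. by move=> PQ; apply: negligibleS => t; apply: contra_not; exact: PQ. Qed.

Lemma abs_cont_sub g a b u v : a <= u -> v <= b ->
  abs_cont g a b -> abs_cont g u v.
Proof.
move=> au vb gac eps e0; have [delta d0 hd] := gac eps e0.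
exists delta => // n c d cd1 cd2; apply: hd => // k /cd1[? [? ?]].
by repeat split => //; lra.
Qed.

Lemma abs_cont_modulus g a b : abs_cont g a b -> forall eps : R, 0 < eps ->
  exists2 delta, 0 < delta & forall u v, a <= u -> u <= v -> v <= b ->
    v - u < delta -> `|g v - g u| < eps.
Proof.
move=> gac eps e0; have [delta d0 hd] := gac eps e0.
exists delta => // u v au uv vb duv.
have := hd 1%N (fun=> u) (fun=> v); rewrite !big_ord1; apply=> //.
Qed.

(** Above [c] the function falls at rate at least [kappa], so it meets the level by time
    [t0 + (g t0 - c) / kappa]. It cannot leave again: after the last time at or below [c] it would
    have to decrease. *)
Lemma abs_cont_trap g t0 (c kappa : R) : 0 < kappa ->
  (forall T, t0 <= T -> abs_cont g t0 T) ->
  {ae mu, forall t, t0 < t -> c < g t ->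
     derivable g t 1 /\ derive1 g t <= - kappa} ->
  exists2 T, t0 <= T & forall t, T <= t -> g t <= c.
Proof.
move=> k0 gac gae.
have dec u v : t0 <= u -> u <= v -> (forall s, u < s <= v -> c < g s) ->
    g v <= g u - kappa * (v - u).
  move=> tu uv gc.
  suff : g v - g u <= - kappa * (v - u) by lra.
  apply: abs_cont_derive_le => //.
    by apply: (abs_cont_sub tu (lexx v)); apply: gac; lra.
  apply: ae_sub gae => s h /andP[us sv]; apply: h; first by lra.
  by apply: gc; rewrite us ltW.
have stay a : t0 <= a -> g a <= c -> forall t, a <= t -> g t <= c.
  move=> ta gac' t at_; rewrite leNgt; apply/negP => gt.
  pose S := [set s | a <= s <= t /\ g s <= c].
  have Sa : S a by split => //; rewrite lexx.
  have supS : has_sup S by split; [exists a | exists t => s [/andP[]]].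
  have a_s : a <= sup S by apply: ub_le_sup => //; case: supS.
  have st : sup S <= t by apply: ge_sup => [|s [/andP[]]//]; exists a.
  have gs : g (sup S) <= c.
    apply/ler_addgt0Pr => eps e0.
    have [|delta d0 hd] := abs_cont_modulus (gac t _) e0; first by lra.
    have [s [/andP[as_ st'] gsc] ss] := sup_adherent d0 supS.
    have sS : s <= sup S by apply: ub_le_sup; [case: supS|split=> //; rewrite as_].
    have := hd s (sup S); rewrite ltr_norml => /(_ _ _ _ _)/andP[] //; lra.
  have : g t <= g (sup S) - kappa * (t - sup S).
    apply: dec => //; first by lra.
    move=> s /andP[ss st']; rewrite ltNge; apply/negP => gsc.
    have : s <= sup S.
      by apply: ub_le_sup; [case: supS|split=> //; apply/andP; split; lra].
    lra.
  have : 0 <= kappa * (t - sup S) by rewrite mulr_ge0 ?subr_ge0// ltW.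
  lra.
suff [T tT gT] : exists2 T, t0 <= T & g T <= c.
  by exists T => // t; exact: stay.
have [//|h] := pselect (exists2 T, t0 <= T & g T <= c).
have gc s : t0 <= s -> c < g s.
  by move=> ts; rewrite ltNge; apply/negP => gs; apply: h; exists s.
pose T := t0 + (g t0 - c) / kappa.
have g0 := gc t0 (lexx _).
have tT : t0 <= T by rewrite lerDl divr_ge0//; lra.
exists T => //; have := dec t0 T (lexx _) tT.
have -> : kappa * (T - t0) = g t0 - c by rewrite /T; field; rewrite gt_eqF.
move=> hT; have : g T <= g t0 - (g t0 - c).
  by apply: hT => s /andP[ts _]; apply: gc; exact: ltW.
lra.
Qed.

Section Vector.
Variable N : nat.
Variables (x : R -> 'rV[R]_N) (a b : R).
Hypothesis x_ac : abs_continuous_on x a b.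

Lemma abs_continuous_on_bounded :
  exists2 M, 0 <= M & forall t, a <= t <= b -> `|x t| <= M.
Proof.
have [ab|ba] := leP a b; last first.
  by exists 0 => // t /andP[at_ tb]; lra.
have [delta d0 hd] := x_ac ltr01.
have hd1 u v : a <= u -> u <= v -> v <= b -> v - u < delta -> `|x v - x u| < 1.
  move=> au uv vb duv.
  by have := hd 1%N (fun=> u) (fun=> v); rewrite !big_ord1; apply.
pose P s := exists2 M, 0 <= M & forall t, a <= t <= s -> `|x t| <= M.
apply: (@real_induction _ P _ _ ab).
  exists `|x a| => // t; rewrite -eq_le => /eqP -> //.
move=> t /andP[at_ tb]; exists (delta / 2); first by lra.
move=> u v au tu ut tv vt vb [M M0 hM]; exists (M + 1); first by lra.
move=> s /andP[as_ sv]; have [su|us] := leP s u.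
  by have := hM s; rewrite as_ su => /(_ isT); lra.
have := hM u; rewrite au lexx => /(_ isT) xu.
have := hd1 u s au (ltW us) (le_trans sv vb).
have := ler_normD (x s - x u) (x u); rewrite subrK => h1 h2.
have : s - u < delta by lra.
by move=> /h2; lra.
Qed.

(** The Lipschitz bound is required along the trajectory only, since [spread] is quadratic and hence
    Lipschitz only on bounded sets. *)
Lemma abs_cont_comp (V : 'rV[R]_N -> R) (K : R) : 0 < K ->
  (forall s t, a <= s <= b -> a <= t <= b ->
     `|V (x s) - V (x t)| <= K * `|x s - x t|) ->
  abs_cont (V \o x) a b.
Proof.
move=> K0 VK eps e0; have [delta d0 hd] := x_ac (divr_gt0 e0 K0).
exists delta => // n c d cd1 cd2 cds.
apply: le_lt_trans (_ : K * \sum_(k < n) `|x (d k) - x (c k)| < _).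
  rewrite mulr_sumr; apply: ler_sum => k _; have [? [? ?]] := cd1 k (ltn_ord k).
  by apply: VK; apply/andP; split; lra.
by rewrite mulrC -ltr_pdivlMr// hd.
Qed.

End Vector.

End Trap.

(** * The Filippov set of the median field *)

Section NullSets.
Variable R : realType.
Local Notation mu := (@lebesgue_measure R).

(* Slicing along the last coordinate multiplies the weight of each box by the
   indicator of its last side, which is why arbitrary weights are allowed. *)
Lemma weighted_box_cover (N : nat) (l u : nat -> R) (a b : nat -> nat -> R)
    (c : R) (w : nat -> R) :
  0 <= c -> (forall k, 0 <= w k) -> (forall i, (i < N)%N -> l i <= u i) ->
  (forall k i, (i < N)%N -> a k i <= b k i) ->
  (forall y : nat -> R, (forall i, (i < N)%N -> l i <= y i <= u i) ->
     (c%:E <= \sum_(0 <= k <oo)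
        (w k * \prod_(i < N) \1_(`[a k i, b k i]) (y i))%:E)%E) ->
  ((c * \prod_(i < N) (u i - l i))%:E <=
     \sum_(0 <= k <oo) (w k * \prod_(i < N) (b k i - a k i))%:E)%E.
Proof.
elim: N w => [|N IH] w c0 w0 lu ab hc.
  have := hc (fun=> 0); rewrite big_ord0 mulr1 => /(_ _)/le_trans; apply => //.
  by apply: lee_nneseries => [k _|k _]; rewrite !big_ord0 ?lee_fin mulr1.
pose Q k := \prod_(i < N) (b k i - a k i).
have Q0 k : 0 <= Q k.
  by apply: prodr_ge0 => i _; rewrite subr_ge0 ab// ltnS ltnW.
pose P := \prod_(i < N) (u i - l i).
have P0 : 0 <= P.
  by apply: prodr_ge0 => i _; rewrite subr_ge0 lu// ltnS ltnW.
have slice t : l N <= t <= u N ->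
    ((c * P)%:E <= \sum_(0 <= k <oo) (w k * Q k * \1_(`[a k N, b k N]) t)%:E)%E.
  move=> lt; have := IH (fun k => w k * \1_(`[a k N, b k N]) t) c0.
  move=> h; apply: le_trans (h _ _ _ _) _.
  - by move=> k; rewrite mulr_ge0.
  - by move=> i iN; apply: lu; rewrite ltnS ltnW.
  - by move=> k i iN; apply: ab; rewrite ltnS ltnW.
  - move=> y hy; have := hc (fun i => if (i < N)%N then y i else t).
    move=> h'; apply: le_trans (h' _) _.
      move=> i; rewrite ltnS leq_eqVlt => /predU1P[->|iN].
        by rewrite ltnn.
      by rewrite iN hy.
    apply: lee_nneseries => k _.
      by rewrite lee_fin mulr_ge0// prodr_ge0.
    rewrite big_ord_recr/= ltnn lee_fin.
    under eq_bigr do rewrite ltn_ord.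
    by rewrite mulrA mulrAC.
  apply: lee_nneseries => k _.
    by rewrite lee_fin mulr_ge0 ?mulr_ge0 ?Q0.
  by rewrite lee_fin mulrAC.
have mf k : measurable_fun `[l N, u N]
    (fun t => (w k * Q k * \1_(`[a k N, b k N]) t)%:E).
  by apply/measurable_EFinP; apply: measurable_funM => //; exact: measurable_indic.
(* Integrating over the last coordinate multiplies the left side by [u N - l N]; on the right, after
   exchange with the sum, each indicator integrates to at most the last side of its box. *)
have : (\int[mu]_(t in `[l N, u N]) (c * P)%:E <= \int[mu]_(t in `[l N, u N])
    \sum_(0 <= k <oo) (w k * Q k * \1_(`[a k N, b k N]) t)%:E)%E.
  apply: ge0_le_integral => //.
  - by move=> t _; rewrite lee_fin mulr_ge0.
  - apply: ge0_emeasurable_sum => //.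
      by move=> k t _ _; rewrite lee_fin !mulr_ge0.
    by move=> k _; exact: mf.
move=> intle; apply: (le_trans _ (le_trans intle _)).
  rewrite [leRHS](_ : _ = (c * P)%:E * mu `[l N, u N])%E; last first.
    exact: integral_cst.
  rewrite lebesgue_measure_itv/= big_ord_recr/= -/P mulrA lte_fin.
  case: ltP => [_|ul]; first by [].
  have -> : u N - l N = 0 by have := lu N (ltnSn _); lra.
  by rewrite mulr0 mule0.
rewrite integral_nneseries => [||k|k t _]//; last 2 first.
- exact: mf.
- by rewrite lee_fin !mulr_ge0.
apply: lee_nneseries => [k _ _|k _].
  by apply: integral_ge0 => t _; rewrite lee_fin !mulr_ge0.
under eq_integral do rewrite EFinM.
rewrite ge0_integralZl_EFin//; last 2 first.
- by apply/measurable_EFinP; exact: measurable_indic.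
- by rewrite mulr_ge0.
rewrite integral_indic// big_ord_recr/= -/(Q k) mulrA [leRHS]EFinM.
apply: lee_wpmul2l; first by rewrite lee_fin mulr_ge0.
apply: le_trans (_ : mu `[a k N, b k N] <= _)%E.
  by apply: le_measure; rewrite ?inE//; exact: measurableI.
rewrite lebesgue_measure_itv/= lte_fin; case: ltP => [_|_].
  by rewrite -EFinB.
by rewrite lee_fin subr_ge0 ab.
Qed.

(** Otherwise the box would be covered by boxes of total volume at most half its own, contrary to
    [weighted_box_cover] with unit weights. *)
Lemma nullN_box_notin (N : nat) (S : set 'rV[R]_N) (l u : 'rV[R]_N) :
  nullN S -> (forall i, l 0 i < u 0 i) ->
  exists2 p, ~ S p & forall i, l 0 i <= p 0 i <= u 0 i.
Proof.
move=> nS lu.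
have [//|h] := pselect (exists2 p, ~ S p & forall i, l 0 i <= p 0 i <= u 0 i).
have inS (p : 'rV[R]_N) : (forall i, l 0 i <= p 0 i <= u 0 i) -> S p.
  by move=> hp; have [//|nSp] := pselect (S p); case: h; exists p.
pose v := \prod_(i < N) (u 0 i - l 0 i).
have v0 : 0 < v by apply: prodr_gt0 => i _; rewrite subr_gt0.
have v20 : 0 < v / 2 by lra.
have [a [b [ab [Scov sum_lt]]]] := nS _ v20.
(* [weighted_box_cover] indexes coordinates by [nat] for its induction on the dimension; row vectors
   are padded with 0. *)
pose ext (p : 'rV[R]_N) (i : nat) := if insub i is Some j then p 0 j else 0.
have extE (p : 'rV[R]_N) (i : 'I_N) : ext p i = p 0 i by rewrite /ext valK.
suff : ((1 * \prod_(i < N) (ext u i - ext l i))%:E <= \sum_(0 <= k <oo)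
    (1 * \prod_(i < N) (ext (b k) i - ext (a k) i))%:E)%E; last first.
  apply: (@weighted_box_cover N (ext l) (ext u) (fun k => ext (a k))
    (fun k => ext (b k)) 1 (fun=> 1)) => //.
  - by move=> i iN; rewrite -[i]/(val (Ordinal iN)) !extE ltW.
  - by move=> k i iN; rewrite -[i]/(val (Ordinal iN)) !extE.
  move=> y hy.
  have /Scov[k _ /= yk] : S (\row_i y i).
    by apply: inS => i; rewrite mxE -!extE hy.
  apply: le_trans (_ : \sum_(0 <= j < k.+1)
     (1 * \prod_(i < N) \1_`[ext (a j) i, ext (b j) i] (y i))%:E <= _)%E; last first.
    by apply: nneseries_lim_ge => j _ _; rewrite lee_fin mul1r prodr_ge0.
  rewrite big_nat_recr//= -[X in (X <= _)%E]add0e leeD//.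
    by apply: sume_ge0 => j _; rewrite lee_fin mul1r prodr_ge0.
  rewrite mul1r big1// => i _; have := yk i; rewrite mxE !extE => yki.
  by rewrite indicE mem_set//= in_itv.
move=> vol_le; exfalso; move: vol_le; apply/negP; rewrite -ltNge.
have -> : 1 * \prod_(i < N) (ext u i - ext l i) = v.
  by rewrite mul1r; apply: eq_bigr => i _; rewrite !extE.
apply: (@le_lt_trans _ _ (v / 2)%:E); last by rewrite lte_fin; lra.
apply: lime_le.
  apply: is_cvg_nneseries => k _ _; rewrite lee_fin mul1r prodr_ge0// => i _.
  by rewrite !extE subr_ge0.
apply: nearW => n; rewrite sumEFin lee_fin big_mkord; apply/ltW.
apply: le_lt_trans (sum_lt n); apply: ler_sum => k _; rewrite mul1r.
by under eq_bigr do rewrite !extE.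
Qed.

Lemma nullN0 (N : nat) : (0 < N)%N -> @nullN R N set0.
Proof.
move=> N0 eps e0; exists (fun=> 0), (fun=> 0); split=> [k i|]; first by [].
split=> // n; rewrite big1// => k _.
by rewrite (bigD1 (Ordinal N0))//= mxE subrr mul0r.
Qed.

End NullSets.

Section FilippovField.
Variables (R : realType) (N : nat) (e : rel 'I_N).
Variables (z : 'I_N -> R) (s : 'I_N -> bool) (gamma : R).
Hypotheses (N_gt0 : (0 < N)%N) (gamma_gt0 : 0 < gamma).
Implicit Types x y v : 'rV[R]_N.

Let f := median_field e z s gamma.

Lemma median_fieldE y i :
  f y 0 i = (s i)%:R * sgn (z i - y 0 i) + gamma * lap e y i.
Proof. by rewrite mxE. Qed.

Lemma sgn_gt0 (r : R) : 0 < r -> sgn r = 1.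
Proof. by move=> r0; rewrite /sgn gt_eqF// gtr0_norm// divff// gt_eqF. Qed.

Lemma sgn_lt0 (r : R) : r < 0 -> sgn r = - 1.
Proof.
by move=> r0; rewrite /sgn lt_eqF// ltr0_norm// invrN mulrN divff// lt_eqF.
Qed.

Lemma sgn_bound (r : R) : - 1 <= sgn r <= 1.
Proof.
have [r0|r0|->] := ltgtP r 0; last by rewrite /sgn eqxx; lra.
  by rewrite sgn_lt0//; lra.
by rewrite sgn_gt0//; lra.
Qed.

(** The lower and upper semicontinuous envelopes of the field. They differ only for active [i] with
    [x_i = z_i], where the sign becomes -1 here and 1 in [median_hi]. *)
Definition median_lo x i : R :=
  gamma * lap e x i + (s i)%:R * (if x 0 i < z i then 1 else - 1).

Definition median_hi x i : R :=
  gamma * lap e x i + (s i)%:R * (if z i < x 0 i then - 1 else 1).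

Lemma lap_near x y (delta : R) : 0 <= delta ->
  (forall j, `|x 0 j - y 0 j| <= delta) ->
  forall i, `|lap e y i - lap e x i| <= N%:R * (2 * delta).
Proof.
move=> d0 h i; rewrite /lap -sumrB; apply: le_trans (ler_norm_sum _ _ _) _.
apply: le_trans (_ : \sum_(j < N) 2 * delta <= _); last first.
  by rewrite sumr_const card_ord -[_ *+ N]mulr_natl.
rewrite big_mkcond; apply: ler_sum => j _; case: ifP => _; last by lra.
by have := h i; have := h j; rewrite !ler_norml; lra.
Qed.

Lemma median_field_near x (eps : R) : 0 < eps ->
  exists2 delta : R, 0 < delta & forall y, (forall j, `|x 0 j - y 0 j| < delta) ->
    forall i, median_lo x i - eps <= f y 0 i <= median_hi x i + eps.
Proof.
move=> e0.
have c0 : 0 < gamma * (N%:R * 2) by rewrite mulr_gt0// mulr_gt0// ltr0n.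
(* On a surface there is no sign to protect, so any positive value would do. *)
pose D i := if x 0 i == z i then 1 else `|x 0 i - z i|.
have D0 i : 0 < D i.
  by rewrite /D; case: eqVneq => // xz; rewrite normr_gt0 subr_eq0.
pose delta := \big[Num.min/(eps / (gamma * (N%:R * 2)))]_(i < N) D i.
have dD i : delta <= D i by exact: bigmin_le_cond.
have de : delta <= eps / (gamma * (N%:R * 2)) by exact: bigmin_le_id.
have d0 : 0 < delta by apply/bigmin_gtP; split=> //; rewrite divr_gt0.
exists delta => // y xy i.
have h1 : gamma * `|lap e y i - lap e x i| <= eps.
  have := @lap_near x y delta (ltW d0) (fun j => ltW (xy j)) i.
  rewrite -(ler_pM2l gamma_gt0) => /le_trans; apply.
  by move: de; rewrite ler_pdivlMr//; congr (_ <= _); ring.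
have h2 : `|gamma * (lap e y i - lap e x i)| <= eps.
  by rewrite normrM gtr0_norm.
have {h1 h2} : - eps <= gamma * lap e y i - gamma * lap e x i <= eps.
  by rewrite -mulrBr -ler_norml.
rewrite median_fieldE /median_lo /median_hi; set A := gamma * _; set B := gamma * _.
move=> /andP[AB1 AB2].
have := sgn_bound (z i - y 0 i).
have := xy i; have := dD i; rewrite /D.
case: (s i) => /=; last by rewrite !mul0r => *; lra.
rewrite !mul1r.
have [xz|xz|->] := ltgtP (x 0 i) (z i); last by lra.
  rewrite ltr0_norm ?subr_lt0// => dz; rewrite ltr_norml => xyi.
  by rewrite sgn_gt0; lra.
rewrite gtr0_norm ?subr_gt0// => dz; rewrite ltr_norml => xyi.
by rewrite sgn_lt0; lra.
Qed.

Lemma ball_rowP x y (delta : R) : 0 < delta ->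
  ball x delta y <-> forall j, `|x 0 j - y 0 j| < delta.
Proof.
move=> d0; split; first by move=> [_ h] j; exact: (h 0 j).
by move=> h; split=> // i j; rewrite (ord1 i); exact: h.
Qed.

(** The enlarged box is convex and contains the field near [x], hence also convex combinations and,
    up to another [eps], their limits. Testing with the empty null set is enough. *)
Lemma filippov_median_bounds x v i : filippov_map f x v ->
  median_lo x i <= v 0 i <= median_hi x i.
Proof.
move=> xv.
suff key (eps : R) : 0 < eps -> median_lo x i - eps <= v 0 i <= median_hi x i + eps.
  apply/andP; split; last by apply/ler_addgt0Pr => eps /key/andP[].
  by apply/ler_addgt0Pr => eps /key/andP[]; lra.
move=> e0; have e2 : 0 < eps / 2 by lra.
have [delta d0 hd] := median_field_near x e2.
have := xv _ d0 _ (nullN0 N_gt0) => /(_ (ball v (eps / 2))).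
case=> [|w [[n [a [p [a0 [a1 [pA ->]]]]]]]]; first exact: nbhsx_ballx.
rewrite ball_rowP// => /(_ i); rewrite summxE.
have pb k : median_lo x i - eps / 2 <= p k 0 i <= median_hi x i + eps / 2.
  have [y [yb _] <-] := pA k.
  by apply: hd; apply/ball_rowP.
have : \sum_k a k * (median_lo x i - eps / 2) <= \sum_k (a k *: p k) 0 i.
  by apply: ler_sum => k _; rewrite mxE ler_wpM2l//; have /andP[] := pb k.
have : \sum_k (a k *: p k) 0 i <= \sum_k a k * (median_hi x i + eps / 2).
  by apply: ler_sum => k _; rewrite mxE ler_wpM2l//; have /andP[] := pb k.
by rewrite -!mulr_suml a1 !mul1r ltr_norml; lra.
Qed.

Section Hull.
Variables (x v : 'rV[R]_N) (S : set 'rV[R]_N).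
Hypothesis v_box : forall i, median_lo x i <= v 0 i <= median_hi x i.
Hypothesis S_null : nullN S.

(* [v] is the mean of the field over independent random signs: coordinate [i] of
   the evaluation point lies below [z_i] with probability [hull_prob i]. *)
Definition hull_prob i : R :=
  if x 0 i < z i then 1 else if z i < x 0 i then 0 else
  if s i then (v 0 i - gamma * lap e x i + 1) / 2 else 0.

Lemma hull_prob_bound i : 0 <= hull_prob i <= 1.
Proof.
rewrite /hull_prob; have := v_box i; rewrite /median_lo /median_hi.
by case: ltgtP => _; case: (s i) => /= h; lra.
Qed.

Lemma hull_probE i :
  v 0 i = gamma * lap e x i + (s i)%:R * (2 * hull_prob i - 1).
Proof.
rewrite /hull_prob; have := v_box i; rewrite /median_lo /median_hi.
by case: ltgtP => _; case: (s i) => /= h; lra.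
Qed.

Definition pattern_weight (sg : {ffun 'I_N -> bool}) : R :=
  \prod_i (if sg i then hull_prob i else 1 - hull_prob i).

Lemma pattern_weight_ge0 sg : 0 <= pattern_weight sg.
Proof.
by apply: prodr_ge0 => i _; have := hull_prob_bound i; case: ifP => _; lra.
Qed.

Lemma sum_pattern_weight : \sum_sg pattern_weight sg = 1.
Proof.
have := bigA_distr_bigA (fun i (b : bool) => if b then hull_prob i else 1 - hull_prob i).
move=> /= <-; apply: big1 => i _; rewrite big_bool /=; ring.
Qed.

(** The expected sign in coordinate [i] under the product weight: exchanging sum and product leaves
    a factor 1 for every other coordinate. *)
Lemma sum_pattern_sign i :
  \sum_sg pattern_weight sg * (if sg i then 1 else - 1) = 2 * hull_prob i - 1.
Proof.
pose F j (b : bool) := (if b then hull_prob j else 1 - hull_prob j) *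
  (if j == i then (if b then 1 else - 1) else 1).
rewrite (eq_bigr (fun sg : {ffun 'I_N -> bool} => \prod_j F j (sg j))); last first.
  move=> sg _; rewrite /F big_split/=; congr (_ * _).
  by rewrite (bigD1 i)//= eqxx big1 ?mulr1// => j /negbTE ->.
have <- := bigA_distr_bigA F.
rewrite (bigD1 i)//= [X in _ * X]big1 => [|j /negbTE ji];
  rewrite big_bool /F/= ?eqxx ?ji; ring.
Qed.

(** The box keeps a distance [delta / 4] from [x] on the prescribed side of each coordinate, and its
    sides of length [delta / 4] give it positive volume, so it is not contained in [S]. *)
Lemma pattern_point (delta : R) (sg : {ffun 'I_N -> bool}) : 0 < delta ->
  exists p, [/\ ~ S p, forall i, `|x 0 i - p 0 i| < delta &
    forall i, x 0 i = z i -> sgn (z i - p 0 i) = if sg i then 1 else - 1].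
Proof.
move=> d0.
pose l : 'rV[R]_N := \row_i (if sg i then x 0 i - delta / 2 else x 0 i + delta / 4).
pose u : 'rV[R]_N := \row_i (if sg i then x 0 i - delta / 4 else x 0 i + delta / 2).
have [|p nSp hp] := @nullN_box_notin _ _ S l u S_null.
  by move=> i; rewrite !mxE; case: ifP => _; lra.
exists p; split=> // i; have := hp i; rewrite !mxE.
  by case: ifP => _ h; rewrite ltr_norml; lra.
by move=> h xz; rewrite -xz; move: h; case: ifP => _ h;
  [rewrite sgn_gt0|rewrite sgn_lt0]; lra.
Qed.

(** Averaging the field over all patterns reproduces [v] up to the variation [E] of the Laplacian
    term, which the choice of [delta] keeps below [eps / 2]. *)
Lemma hull_approx (eps : R) : 0 < eps ->
  exists2 w, convex_hull (f @` (ball x eps `\` S)) w &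
    forall i, `|v 0 i - w 0 i| < eps.
Proof.
move=> e0.
have c0 : 0 < gamma * (N%:R * 2) by rewrite mulr_gt0// mulr_gt0// ltr0n.
pose D i := if x 0 i == z i then 1 else `|x 0 i - z i|.
have D0 i : 0 < D i.
  by rewrite /D; case: eqVneq => // xz; rewrite normr_gt0 subr_eq0.
pose de0 := Num.min eps (eps / 2 / (gamma * (N%:R * 2))).
have de00 : 0 < de0 by rewrite lt_min e0/= !divr_gt0.
pose delta := \big[Num.min/de0]_(i < N) D i.
have dD i : delta <= D i by exact: bigmin_le_cond.
have dde0 : delta <= de0 by exact: bigmin_le_id.
have de : delta <= eps by apply: le_trans dde0 _; rewrite ge_min lexx.
have de' : delta <= eps / 2 / (gamma * (N%:R * 2)).
  by apply: le_trans dde0 _; rewrite ge_min lexx orbT.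
have d0 : 0 < delta by apply/bigmin_gtP; split.
have [p hp] := choice (fun sg => pattern_point sg d0).
pose w := \sum_sg pattern_weight sg *: f (p sg).
have sumE (V : nmodType) (F : {ffun 'I_N -> bool} -> V) :
    \sum_(k < #|{: {ffun 'I_N -> bool}}|) F (enum_val k) = \sum_sg F sg.
  by rewrite -big_enum_val; apply: eq_bigl => sg; rewrite inE.
exists w.
  exists #|{: {ffun 'I_N -> bool}}|, (fun k => pattern_weight (enum_val k)),
    (fun k => f (p (enum_val k))); split; [|split; [|split]].
  - by move=> k; exact: pattern_weight_ge0.
  - by rewrite -sum_pattern_weight -sumE.
  - move=> k; exists (p (enum_val k)) => //; have [nS xp _] := hp (enum_val k).
    split=> //; apply/ball_rowP => // j; exact: lt_le_trans (xp j) de.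
  - by rewrite /w -sumE.
move=> i; rewrite /w summxE.
have fE sg : f (p sg) 0 i = gamma * lap e x i + gamma * (lap e (p sg) i - lap e x i) +
   (s i)%:R * sgn (z i - p sg 0 i) by rewrite median_fieldE; ring.
have sgE : \sum_sg pattern_weight sg * sgn (z i - p sg 0 i) = 2 * hull_prob i - 1.
  have := dD i; rewrite /D.
  have [xz|xz|xz] := ltgtP (x 0 i) (z i).
  - rewrite ltr0_norm ?subr_lt0// => dz.
    under eq_bigr => sg _.
      rewrite sgn_gt0; last first.
        by have [_ /(_ i)] := hp sg; rewrite ltr_norml => *; lra.
      over.
    by rewrite -mulr_suml sum_pattern_weight /hull_prob xz; ring.
  - rewrite gtr0_norm ?subr_gt0// => dz.
    under eq_bigr => sg _.
      rewrite sgn_lt0; last first.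
        by have [_ /(_ i)] := hp sg; rewrite ltr_norml => *; lra.
      over.
    by rewrite -mulr_suml sum_pattern_weight /hull_prob xz ltNge (ltW xz)/=; ring.
  - move=> _; rewrite -sum_pattern_sign; apply: eq_bigr => sg _.
    by have [_ _ /(_ i xz) ->] := hp sg.
pose E := \sum_sg pattern_weight sg * (gamma * (lap e (p sg) i - lap e x i)).
have -> : \sum_sg (pattern_weight sg *: f (p sg)) 0 i = v 0 i + E.
  have cE : gamma * lap e x i = \sum_sg pattern_weight sg * (gamma * lap e x i).
    by rewrite -mulr_suml sum_pattern_weight mul1r.
  rewrite hull_probE -sgE mulr_sumr [X in _ = X + _ + _]cE.
  rewrite -!big_split/=; apply: eq_bigr => sg _.
  by rewrite mxE fE; ring.
rewrite opprD addrA subrr add0r normrN.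
apply: (@le_lt_trans _ _ (eps / 2)); last by lra.
apply: le_trans (ler_norm_sum _ _ _) _.
have -> : eps / 2 = \sum_sg pattern_weight sg * (eps / 2).
  by rewrite -mulr_suml sum_pattern_weight mul1r.
apply: ler_sum => sg _.
rewrite normrM ger0_norm ?pattern_weight_ge0// ler_wpM2l ?pattern_weight_ge0//.
rewrite normrM gtr0_norm//.
have xp j : `|x 0 j - p sg 0 j| <= delta by have [_ /(_ j)/ltW] := hp sg.
have lapb := lap_near (ltW d0) xp i.
apply: le_trans (ler_wpM2l (ltW gamma_gt0) lapb) _.
by move: de'; rewrite ler_pdivlMr//; congr (_ <= _); ring.
Qed.

End Hull.

Lemma filippov_medianE x v : filippov_map f x v <->
  forall i, median_lo x i <= v 0 i <= median_hi x i.
Proof.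
split=> [xv i|v_box]; first exact: filippov_median_bounds.
move=> delta d0 S S_null B /nbhs_ballP[r /= r0 rB].
pose eps := Num.min delta r.
have e0 : 0 < eps by rewrite lt_min d0.
have [w [n [a [p [a0 [a1 [pA wE]]]]]] vw] := hull_approx v_box S_null e0.
exists w; split.
  exists n, a, p; do !split=> //; move=> k; have [y [yb nS] <-] := pA k.
  exists y => //; split=> //; apply: le_ball yb; by rewrite ge_min lexx.
apply: rB; apply/ball_rowP => // j; apply: lt_le_trans (vw j) _.
by rewrite ge_min lexx orbT.
Qed.

End FilippovField.

(** * Asymptotics *)

Section Spread.
Variables (R : realType) (N : nat).
Hypothesis N_gt0 : (0 < N)%N.
Implicit Types x y v w : 'rV[R]_N.

Let NR_gt0 : 0 < N%:R :> R. Proof. by rewrite ltr0n. Qed.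

Definition mean y : R := (\sum_i y 0 i) / N%:R.

(** N times the variance, as a polynomial in sums that can be differentiated termwise;
    [sqnorm_deviation] gives the centred form. *)
Definition spread y : R := \sum_i y 0 i ^+ 2 - (\sum_i y 0 i) ^+ 2 / N%:R.

Definition deviation y : 'rV[R]_N := \row_i (y 0 i - mean y).

Lemma sum_mean y : \sum_i y 0 i = N%:R * mean y.
Proof. by rewrite /mean mulrC divfK// gt_eqF. Qed.

Lemma sum_deviation y : \sum_i deviation y 0 i = 0.
Proof.
under eq_bigr do rewrite mxE.
by rewrite sumrB sum_mean sumr_const card_ord mulr_natl subrr.
Qed.

Lemma sqnorm_deviation y : sqnorm (deviation y) = spread y.
Proof.
rewrite /sqnorm /spread.
have -> : \sum_i deviation y 0 i ^+ 2 =
    \sum_i y 0 i ^+ 2 - 2 * mean y * \sum_i y 0 i + N%:R * mean y ^+ 2.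
  have -> : N%:R * mean y ^+ 2 = \sum_(i < N) mean y ^+ 2.
    by rewrite sumr_const card_ord mulr_natl.
  rewrite mulr_sumr -sumrB -big_split/=.
  by apply: eq_bigr => i _; rewrite mxE; ring.
by rewrite sum_mean; field; rewrite gt_eqF.
Qed.

Lemma lap_deviation (e : rel 'I_N) y i : lap e (deviation y) i = lap e y i.
Proof. by apply: eq_bigr => j _; rewrite !mxE; ring. Qed.

(** Cauchy-Schwarz against the all-ones vector, read off from the nonnegative variance of the
    absolute values. *)
Lemma sqr_sum_norm_le y : (\sum_i `|y 0 i|) ^+ 2 <= N%:R * sqnorm y.
Proof.
set S := \sum_i `|y 0 i|.
have : 0 <= \sum_i (`|y 0 i| - S / N%:R) ^+ 2.
  by apply: sumr_ge0 => i _; rewrite sqr_ge0.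
have -> : \sum_i (`|y 0 i| - S / N%:R) ^+ 2 = sqnorm y - S ^+ 2 / N%:R.
  rewrite (eq_bigr (fun i => y 0 i ^+ 2 - 2 * (S / N%:R) * `|y 0 i| + (S / N%:R) ^+ 2)).
    rewrite big_split/= sumrB -mulr_sumr sumr_const card_ord -/S -/(sqnorm y).
    rewrite -[_ *+ N]mulr_natl.
    by field; rewrite gt_eqF.
  by move=> i _; rewrite -[y 0 i ^+ 2]real_normK ?num_real//; ring.
by rewrite subr_ge0 ler_pdivrMr// mulrC.
Qed.

Lemma entry_le_norm y i : `|y 0 i| <= `|y|.
Proof.
by rewrite [leRHS]/Num.Def.normr/= mx_normrE; exact: (le_bigmax _ _ (0, i)).
Qed.

Lemma mean_lipschitz x y : `|mean x - mean y| <= `|x - y|.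
Proof.
rewrite /mean -mulrBl -sumrB normrM normfV (ger0_norm (ltW NR_gt0)).
rewrite ler_pdivrMr//; apply: le_trans (ler_norm_sum _ _ _) _.
apply: le_trans (_ : \sum_(i < N) `|x - y| <= _).
  by apply: ler_sum => i _; have := entry_le_norm (x - y) i; rewrite !mxE.
by rewrite sumr_const card_ord -[_ *+ N]mulr_natr.
Qed.

Lemma mean_bound y M : (forall i, `|y 0 i| <= M) -> `|mean y| <= M.
Proof.
move=> yM; rewrite /mean normrM normfV (ger0_norm (ltW NR_gt0)) ler_pdivrMr//.
apply: le_trans (ler_norm_sum _ _ _) _.
apply: le_trans (_ : \sum_(i < N) M <= _); first exact: ler_sum.
by rewrite sumr_const card_ord -[_ *+ N]mulr_natr.
Qed.

(** Squared deviations differ by [(a - b) * (a + b)], where the first factor is at most twice the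
    distance and the second at most [4 * M]. *)
Lemma spread_lipschitz x y (M : R) : `|x| <= M -> `|y| <= M ->
  `|spread x - spread y| <= N%:R * (8 * M) * `|x - y|.
Proof.
move=> xM yM; rewrite -!sqnorm_deviation /sqnorm -sumrB.
apply: le_trans (ler_norm_sum _ _ _) _.
apply: le_trans (_ : \sum_(i < N) (8 * M * `|x - y|) <= _); last first.
  by rewrite sumr_const card_ord -[_ *+ N]mulr_natl mulrA.
apply: ler_sum => i _; rewrite !mxE subr_sqr normrM.
have d : `|x 0 i - y 0 i| <= `|x - y|.
  by have := entry_le_norm (x - y) i; rewrite !mxE.
have md := mean_lipschitz x y.
have xi j : `|x 0 j| <= M by exact: le_trans (entry_le_norm _ _) xM.
have yi j : `|y 0 j| <= M by exact: le_trans (entry_le_norm _ _) yM.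
have mx := mean_bound xi; have my := mean_bound yi.
rewrite [leRHS](_ : _ = (2 * `|x - y|) * (4 * M)); last by ring.
apply: ler_pM => //.
  have -> : x 0 i - mean x - (y 0 i - mean y) = (x 0 i - y 0 i) - (mean x - mean y).
    by ring.
  by apply: le_trans (ler_normB _ _) _; lra.
have := xi i; have := yi i; move: mx my; rewrite !ler_norml; lra.
Qed.

Section Derivative.
Variables (x : R -> 'rV[R]_N) (t : R).
Hypothesis x_derivable : derivable x t 1.

Lemma is_derive_entry i :
  is_derive t 1 (fun u => x u 0 i) (derive1 x t 0 i).
Proof.
have /(derivable_mxP _ _ _) di := x_derivable.
rewrite derive1E derive_mx// mxE; exact/derivableP/di.
Qed.

Lemma derive1_entry i : derive1 (fun u => x u 0 i) t = derive1 x t 0 i.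
Proof.
by rewrite derive1E (@derive_val _ _ _ _ _ _ _ (is_derive_entry i)).
Qed.

Lemma is_derive_sum_entries :
  is_derive t 1 (fun u => \sum_i x u 0 i) (\sum_i derive1 x t 0 i).
Proof.
rewrite (_ : (fun u => _) = \sum_i (fun u => x u 0 i)); last first.
  by apply/funext => u; rewrite fct_sumE.
by apply: is_derive_sum => i; exact: is_derive_entry.
Qed.

Lemma is_derive_mean : is_derive t 1 (mean \o x) (mean (derive1 x t)).
Proof.
rewrite (_ : mean \o x = N%:R^-1 \*: (fun u => \sum_i x u 0 i)); last first.
  by apply/funext => u; rewrite /= /mean mulrC.
rewrite /mean mulrC; apply: is_deriveZ; exact: is_derive_sum_entries.
Qed.

Lemma is_derive_spread : is_derive t 1 (spread \o x)
  (2 * \sum_i deviation (x t) 0 i * derive1 x t 0 i).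
Proof.
have -> : spread \o x = \sum_i (fun u => x u 0 i) ^+ 2 -
    N%:R^-1 \*: (fun u => \sum_i x u 0 i) ^+ 2.
  apply/funext => u; rewrite /= /spread -[RHS]/(_ u - _ u) fct_sumE.
  by congr (_ - _); rewrite mulrC.
apply: is_derive_eq.
  apply: is_deriveB.
    by apply: is_derive_sum => i; apply: is_deriveX; exact: is_derive_entry.
  by apply: is_deriveZ; apply: is_deriveX; exact: is_derive_sum_entries.
rewrite /= !expr1 /GRing.scale/=.
set X := \sum_i x t 0 i; set Y := \sum_i derive1 x t 0 i.
have -> : \sum_i deviation (x t) 0 i * derive1 x t 0 i =
    \sum_i x t 0 i * derive1 x t 0 i - mean (x t) * Y.
  by rewrite mulr_sumr -sumrB; apply: eq_bigr => i _; rewrite mxE; ring.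
have -> : \sum_i 2 * x t 0 i * derive1 x t 0 i =
    2 * \sum_i x t 0 i * derive1 x t 0 i.
  by rewrite mulr_sumr; apply: eq_bigr => i _; ring.
by rewrite /mean -/X; field; rewrite gt_eqF.
Qed.

End Derivative.

End Spread.

(** * Medians as majority thresholds *)

Section Median.
Variables (R : realType) (N : nat) (z : 'I_N -> R) (s : 'I_N -> bool).
Hypothesis s_some : exists i, s i.

Let zs := sort <=%R [seq z i | i <- enum 'I_N & s i].

(** Indices start at 0, so one pair of formulas serves both parities: the two indices agree for odd
    size and are the two middle positions for even size. *)
Definition lower_median : R := zs`_((size zs).-1./2).
Definition upper_median : R := zs`_((size zs)./2).

Lemma size_active_gt0 : (0 < size zs)%N.
Proof.
have [i si] := s_some; rewrite size_sort size_map -has_predT.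
by apply/hasP; exists i => //; rewrite mem_filter si mem_enum.
Qed.

Let nth_mono i j : (i <= j)%N -> (j < size zs)%N -> zs`_i <= zs`_j.
Proof.
move=> ij jsz; have zs_s : sorted <=%R zs by exact: sort_le_sorted.
apply: (sorted_leq_nth le_trans le_refl 0 zs_s) => //.
by rewrite inE (leq_ltn_trans ij).
Qed.

Lemma lower_le_upper_median : lower_median <= upper_median.
Proof.
have := size_active_gt0; rewrite /lower_median /upper_median => sz.
by apply: nth_mono; [exact/half_leq/leq_pred|rewrite ltn_half_double -addnn; lia].
Qed.

Lemma median_setE :
  median_set z s = [set y | lower_median <= y <= upper_median].
Proof.
have := size_active_gt0; rewrite /median_set -/zs /lower_median /upper_median.
case: (size zs) => // n _ /=; rewrite uphalf_half; case: (odd n) => /=.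
  by [].
rewrite add0n; apply/seteqP; split=> y /=; first by move=> ->; rewrite lexx.
by move=> /le_anti.
Qed.

Lemma sum_active (F : R -> R) :
  \sum_i (s i)%:R * F (z i) = \sum_(t <- zs) F t.
Proof.
rewrite [RHS](perm_big [seq z i | i <- enum 'I_N & s i]); last first.
  by rewrite perm_sort.
rewrite big_map big_filter big_enum_cond/= [RHS]big_mkcond.
by apply: eq_bigr => i _; case: (s i); rewrite ?mul1r ?mul0r.
Qed.

(** The entries up to index [m] are at most the upper median and form a strict majority, [m.+1] out
    of [size zs]; each counts -1, every other at most 1. *)
Lemma upper_median_balance :
  \sum_i (s i)%:R * (if z i <= upper_median then - 1 else 1) <= - 1 :> R.
Proof.
rewrite (sum_active (fun t => if t <= upper_median then - 1 else 1)).
have sz := size_active_gt0.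
set m := (size zs)./2.
have msz : (m < size zs)%N by rewrite /m ltn_half_double -addnn; lia.
rewrite -[X in \sum_(t <- X) _](cat_take_drop m.+1 zs) big_cat/=.
have h1 : \sum_(t <- take m.+1 zs) (if t <= upper_median then - 1 else 1) =
    - m.+1%:R :> R.
  rewrite big_seq (eq_bigr (fun=> - 1)) => [|t /(nthP 0)[i]].
    rewrite -big_seq big_const_seq count_predT size_take_min (minn_idPl msz).
    by rewrite iter_addr addr0 mulNrn.
  rewrite size_take_min (minn_idPl msz) => im <-; rewrite nth_take//.
  by rewrite ifT// nth_mono.
have h2 : \sum_(t <- drop m.+1 zs) (if t <= upper_median then - 1 else 1) <=
    (size zs - m.+1)%:R :> R.
  rewrite -size_drop -(@count_predT _ (drop _ _)) -sum1_count natr_sum.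
  by apply: ler_sum => t _; case: ifP => _; lra.
have h3 : (size zs - m.+1)%:R + 1 <= m.+1%:R :> R.
  rewrite natr1 ler_nat; have := odd_double_half (size zs); rewrite -/m -addnn.
  by case: (odd _); lia.
rewrite h1; lra.
Qed.

(** Here the strict majority consists of the entries from index [m] on. *)
Lemma lower_median_balance :
  1 <= \sum_i (s i)%:R * (if lower_median <= z i then 1 else - 1) :> R.
Proof.
rewrite (sum_active (fun t => if lower_median <= t then 1 else - 1)).
have sz := size_active_gt0.
set m := (size zs).-1./2.
have msz : (m < size zs)%N by rewrite /m ltn_half_double -addnn; lia.
rewrite -[X in \sum_(t <- X) _](cat_take_drop m zs) big_cat/=.
have h1 : \sum_(t <- drop m zs) (if lower_median <= t then 1 else - 1) =
    (size zs - m)%:R :> R.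
  rewrite big_seq (eq_bigr (fun=> 1)) => [|t /(nthP 0)[i]].
    by rewrite -big_seq big_const_seq count_predT size_drop iter_addr addr0.
  rewrite size_drop => im <-; rewrite nth_drop.
  by rewrite ifT// nth_mono ?leq_addr// -ltn_subRL.
have h2 : - m%:R <= \sum_(t <- take m zs) (if lower_median <= t then 1 else - 1)
    :> R.
  have sz_take : size (take m zs) = m by rewrite size_take_min (minn_idPl (ltnW msz)).
  rewrite -[X in - X%:R]sz_take -(@count_predT _ (take _ _)) -sum1_count natr_sum.
  rewrite -sumrN.
  by apply: ler_sum => t _; case: ifP => _; lra.
have h3 : m%:R + 1 <= (size zs - m)%:R :> R.
  rewrite natr1 ler_nat; have := odd_double_half (size zs).-1; rewrite -/m -addnn.
  by case: (odd _); lia.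
lra.
Qed.

Lemma dist_median_set_le (x r : R) : 0 <= r ->
  lower_median - r <= x <= upper_median + r ->
  dist_set x (median_set z s) <= r.
Proof.
move=> r0 /andP[lx xu]; rewrite median_setE.
have lu := lower_le_upper_median.
have [y yM yx] : exists2 y, lower_median <= y <= upper_median & `|x - y| <= r.
  have [xl|lx'] := ltP x lower_median.
    by exists lower_median; rewrite ?lexx// ler_norml; lra.
  have [xu'|xu'] := leP x upper_median.
    by exists x; rewrite ?lx'// subrr normr0.
  by exists upper_median; rewrite ?lexx ?andbT// ler_norml; lra.
apply: le_trans yx; apply: ge_inf; last by exists y.
by exists 0 => _ [w _ <-].
Qed.

End Median.

(** * Drift of the spread and of the mean *)

Section Drift.
Variables (R : realType) (N : nat) (e : rel 'I_N).
Hypotheses (N_gt0 : (0 < N)%N) (e_sym : symmetric e).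
Hypothesis e_conn : forall i j, connect e i j.
Variable ev : seq R.
Hypothesis ev_char : char_poly (laplacian R e) = \prod_(a <- ev) ('X - a%:P).
Hypothesis ev_sorted : sorted <=%R ev.
Variables (z : 'I_N -> R) (s : 'I_N -> bool) (gamma : R).
Hypotheses (s_some : exists i, s i) (gamma_gt0 : 0 < gamma).
Implicit Types x v : 'rV[R]_N.

Local Notation lo := (median_lo e z s gamma).
Local Notation hi := (median_hi e z s gamma).

(** With [q] the root of the spread, the signs contribute at most [q0 * q] to half the derivative,
    and the coupling at most [- gamma * lam * q ^+ 2]. *)
Lemma spread_drift (rho : R) : Num.sqrt N%:R / (gamma * ev`_1) < rho ->
  0 < rho ->
  exists2 kappa, 0 < kappa & forall x v,
    (forall i, lo x i <= v 0 i <= hi x i) -> rho ^+ 2 < spread x ->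
    2 * \sum_i deviation x 0 i * v 0 i <= - kappa.
Proof.
move=> rho_gt rho0; have [N1|] := ltnP 1 N; last first.
  (* A single node has no spectral gap, but its spread is 0 and never exceeds the level. *)
  move=> N1; have NE : N = 1%N by apply/eqP; rewrite eqn_leq N1.
  exists 1 => // x v _.
  have -> : spread x = 0.
    move: x {v}; rewrite NE => x.
    by rewrite /spread !big_ord1 divr1 subrr.
  by rewrite ltNge sqr_ge0.
have [lam0 gap] := laplacian_gap e_sym e_conn ev_char ev_sorted N1.
set lam := ev`_1 in rho_gt lam0 gap.
have gl0 : 0 < gamma * lam by rewrite mulr_gt0.
set q0 := Num.sqrt N%:R in rho_gt.
have d0 : 0 < gamma * lam * rho - q0.
  by move: rho_gt; rewrite ltr_pdivrMr// subr_gt0 mulrC.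
(* The guaranteed decrease [2 * q * (gamma * lam * q - q0)] grows with [q] beyond [rho], so its
   value at [q = rho] is a uniform rate. *)
exists (2 * rho * (gamma * lam * rho - q0)); first by rewrite !mulr_gt0.
move=> x v vbox xrho.
set y := deviation x.
have y0 : \sum_i y 0 i = 0 by exact: sum_deviation.
have ysq : sqnorm y = spread x by exact: sqnorm_deviation.
set q := Num.sqrt (sqnorm y).
have q2 : q ^+ 2 = sqnorm y.
  by rewrite sqr_sqrtr// ysq ltW// (lt_trans _ xrho)// exprn_gt0.
have qrho : rho < q.
  by rewrite -(@ltr_pXn2r _ 2) ?nnegrE ?sqrtr_ge0 ?q2 ?ysq// ltW.
have sumle : \sum_i y 0 i * v 0 i <= \sum_i `|y 0 i| - gamma * dirichlet e y.
  rewrite /dirichlet mulrN opprK mulr_sumr -big_split/=.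
  apply: ler_sum => i _; rewrite lap_deviation.
  have : `|v 0 i - gamma * lap e x i| <= 1.
    have := vbox i; rewrite /median_lo /median_hi ler_norml.
    by case: (s i) => /=; case: ifP => _; case: ifP => _; lra.
  move=> h; have : y 0 i * (v 0 i - gamma * lap e x i) <= `|y 0 i|.
    apply: le_trans (ler_norm _) _; rewrite normrM.
    by rewrite -[leRHS]mulr1 ler_wpM2l.
  lra.
have gapy := gap _ y0; rewrite -q2 in gapy.
have S1 : \sum_i `|y 0 i| <= q0 * q.
  rewrite -(@ler_pXn2r _ 2) ?nnegrE//; last 2 first.
  - by apply: sumr_ge0.
  - by rewrite mulr_ge0 ?sqrtr_ge0.
  by rewrite exprMn q2 sqr_sqrtr ?ler0n// sqr_sum_norm_le.
have : gamma * (lam * q ^+ 2) <= gamma * dirichlet e y by rewrite ler_pM2l.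
have : rho * (gamma * lam * rho - q0) <= q * (gamma * lam * q - q0).
  apply: ler_pM; rewrite ?(ltW rho0) ?(ltW d0) ?(ltW qrho)//.
  by rewrite lerD2r ler_pM2l// ltW.
lra.
Qed.

Lemma spread_entry x (rho : R) : 0 <= rho -> spread x <= rho ^+ 2 ->
  forall i, `|x 0 i - mean x| <= rho.
Proof.
move=> rho0 h i; rewrite -(@ler_pXn2r _ 2) ?nnegrE// real_normK ?num_real//.
apply: le_trans h; rewrite -sqnorm_deviation//.
by have := sqr_entry_le_sqnorm (deviation x) i; rewrite mxE.
Qed.

Lemma sum_lapD x (F : 'I_N -> R) :
  \sum_i (gamma * lap e x i + F i) = \sum_i F i.
Proof. by rewrite big_split/= -mulr_sumr sum_lap// mulr0 add0r. Qed.

(** The coupling cancels in the sum, so only the signs move the mean; a majority surplus of at least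
    one node gives the rate [N%:R^-1]. *)
Lemma mean_drift_down x v (rho : R) : 0 <= rho -> spread x <= rho ^+ 2 ->
  (forall i, lo x i <= v 0 i <= hi x i) ->
  upper_median z s + rho < mean x -> mean v <= - N%:R^-1.
Proof.
move=> rho0 sp vbox mx; rewrite /mean -mulN1r ler_pM2r ?invr_gt0 ?ltr0n//.
apply: le_trans (upper_median_balance z s_some).
rewrite -[leRHS](sum_lapD x).
apply: ler_sum => i _; have /andP[_ vh] := vbox i; apply: le_trans vh _.
rewrite /median_hi lerD2l; have := spread_entry rho0 sp i; rewrite ler_norml => xm.
case: (s i) => //=; last by rewrite !mul0r.
rewrite !mul1r; case: (leP (z i)) => zu; first by rewrite ifT//; lra.
by case: ifP => _; lra.
Qed.

Lemma mean_drift_up x v (rho : R) : 0 <= rho -> spread x <= rho ^+ 2 ->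
  (forall i, lo x i <= v 0 i <= hi x i) ->
  mean x < lower_median z s - rho -> N%:R^-1 <= mean v.
Proof.
move=> rho0 sp vbox mx; rewrite /mean -[leLHS]mul1r ler_pM2r ?invr_gt0 ?ltr0n//.
apply: le_trans (lower_median_balance z s_some) _.
rewrite -[leLHS](sum_lapD x).
apply: ler_sum => i _; have /andP[vl _] := vbox i; apply: le_trans vl.
rewrite /median_lo lerD2l; have := spread_entry rho0 sp i; rewrite ler_norml => xm.
case: (s i) => //=; last by rewrite !mul0r.
rewrite !mul1r; case: (leP _ (z i)) => zu; first by rewrite ifT//; lra.
by case: ifP => _; lra.
Qed.

Lemma filippov_limsup (x : R -> 'rV[R]_N) (eps : R) :
  filippov_solution (median_field e z s gamma) x -> 0 < eps ->
  exists T : R, forall t : R, T <= t -> forall i : 'I_N,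
    dist_set (x t 0 i) (median_set z s)
      <= 2 * Num.sqrt (N%:R) / (gamma * ev`_1) + eps.
Proof.
move=> [xac xae] e0.
set r := Num.sqrt N%:R / (gamma * ev`_1).
have -> : 2 * Num.sqrt (N%:R) / (gamma * ev`_1) = 2 * r by rewrite mulrA.
have r0 : 0 <= r.
  rewrite divr_ge0 ?sqrtr_ge0// mulr_ge0 ?(ltW gamma_gt0)//.
  have [N1|N1] := ltnP 1 N.
    by have [/ltW] := laplacian_gap e_sym e_conn ev_char ev_sorted N1.
  (* With one node the list has a single entry, so the eigenvalue at index 1 is the default 0. *)
  rewrite nth_default//.
  by have := size_char_poly (laplacian R e); rewrite ev_char size_prod_XsubC => -[->].
(* The level is used twice, for the spread and for the mean, so half of [eps] goes to each. *)
pose rho := r + eps / 2.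
have rho0 : 0 < rho by rewrite /rho; lra.
have rrho : r < rho by rewrite /rho; lra.
have xbox : {ae @lebesgue_measure R, forall t : R, 0 <= t -> derivable x t 1 /\
    forall i, lo (x t) i <= derive1 x t 0 i <= hi (x t) i}.
  apply: ae_sub xae => t ht /ht[dx /filippov_medianE hb]; split=> //.
  exact: hb.
have [kappa k0 hk] := spread_drift rrho rho0.
have NR0 : 0 < N%:R :> R by rewrite ltr0n.
have [T1 T10 hT1] : exists2 T, 0 <= T & forall t, T <= t -> spread (x t) <= rho ^+ 2.
  apply: (@abs_cont_trap _ (@spread R N \o x) 0 (rho ^+ 2) kappa k0).
    move=> T T0; have [M M0 hM] := abs_continuous_on_bounded (xac T T0).
    apply: (@abs_cont_comp _ _ _ _ _ (xac T T0) _ (N%:R * (8 * (M + 1)))).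
      rewrite mulr_gt0 ?NR0// mulr_gt0//; lra.
    move=> u t u0 t0; apply: spread_lipschitz => //.
      by apply: le_trans (hM _ u0) _; lra.
    by apply: le_trans (hM _ t0) _; lra.
  apply: ae_sub xbox => t ht t0 gt; have [dx vb] := ht (ltW t0).
  have ds := is_derive_spread N_gt0 dx.
  split; first exact: (@ex_derive _ _ _ _ _ _ _ ds).
  by rewrite derive1E (@derive_val _ _ _ _ _ _ _ ds); exact: hk.
have mac T T' : T1 <= T -> abs_cont (@mean R N \o x) T T'.
  move=> TT; have [TT'|T'T] := leP T T'.
    apply: (@abs_cont_sub _ _ 0 T') => //; first exact: le_trans TT.
    apply: (@abs_cont_comp _ _ _ _ _ (xac T' _) _ 1) => //; first by lra.
    by move=> u t _ _; rewrite mul1r; exact: mean_lipschitz.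
  move=> eps' e0'; exists 1 => // n c d cd _ _; rewrite big1// => k _.
  by have [? [? ?]] := cd k (ltn_ord k); lra.
have [T2 T12 hT2] : exists2 T, T1 <= T & forall t, T <= t ->
    mean (x t) <= upper_median z s + rho.
  apply: (@abs_cont_trap _ (@mean R N \o x) T1 _ N%:R^-1).
  - by rewrite invr_gt0.
  - by move=> T TT; exact: mac.
  apply: ae_sub xbox => t ht t0 gt.
  have [|dx vb] := ht; first by lra.
  have ds := is_derive_mean dx.
  split; first exact: (@ex_derive _ _ _ _ _ _ _ ds).
  rewrite derive1E (@derive_val _ _ _ _ _ _ _ ds).
  exact: (mean_drift_down (ltW rho0) (hT1 _ (ltW t0)) vb gt).
have [T3 T13 hT3] : exists2 T, T1 <= T & forall t, T <= t ->
    - mean (x t) <= - (lower_median z s - rho).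
  apply: (@abs_cont_trap _ (fun t => - mean (x t)) T1 _ N%:R^-1).
  - by rewrite invr_gt0.
  - move=> T TT eps' e0'; have [d d0 hd] := mac T1 T (lexx _) eps' e0'.
    exists d => // n a b ab1 ab2 ab3; have := hd n a b ab1 ab2 ab3.
    by congr (_ < _); apply: eq_bigr => k _; rewrite /= -opprD normrN.
  apply: ae_sub xbox => t ht t0; rewrite ltrN2 => gt.
  have [|dx vb] := ht; first by lra.
  have ds := is_deriveN (is_derive_mean dx).
  split; first exact: (@ex_derive _ _ _ _ _ _ _ ds).
  rewrite derive1E (@derive_val _ _ _ _ _ _ _ ds) lerN2.
  exact: (mean_drift_up (ltW rho0) (hT1 _ (ltW t0)) vb gt).
exists (Num.max T2 T3) => t; rewrite ge_max => /andP[T2t T3t] i.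
have -> : 2 * r + eps = 2 * rho by rewrite /rho; field.
apply: dist_median_set_le => //; first by lra.
have := hT2 _ T2t; have := hT3 _ T3t.
have := spread_entry (ltW rho0) (hT1 _ (le_trans T12 T2t)) i.
by rewrite ler_norml; lra.
Qed.

End Drift.

(** * Existence *)

Section Euler.
Variables (R : realType) (N : nat) (e : rel 'I_N).
Variables (z : 'I_N -> R) (s : 'I_N -> bool) (gamma : R) (x0 : 'rV[R]_N).
Hypotheses (N_gt0 : (0 < N)%N) (gamma_gt0 : 0 < gamma) (e_sym : symmetric e).
Implicit Types x y v : 'rV[R]_N.

Local Notation f := (median_field e z s gamma).

Lemma sgn_monotone (a b c : R) : (a - b) * (sgn (c - a) - sgn (c - b)) <= 0.
Proof.
wlog ab : a b / a <= b.
  move=> h; have [/h//|/ltW/h] := leP a b.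
  by congr (_ <= _); ring.
apply: mulr_le0_ge0; rewrite ?subr_le0// subr_ge0.
have := sgn_bound (c - a); have := sgn_bound (c - b).
have [ca|ca|ca] := ltgtP c a.
- have -> : sgn (c - b) = - 1 by apply: sgn_lt0; lra.
  lra.
- have -> : sgn (c - a) = 1 by apply: sgn_gt0; lra.
  lra.
have [bc|bc] := eqVneq b c; first by rewrite bc ca.
have cb : c < b by rewrite lt_def bc ca.
have -> : sgn (c - b) = - 1 by apply: sgn_lt0; lra.
lra.
Qed.

(** Each sign is nonincreasing in its own coordinate and the coupling contributes minus a Dirichlet
    form. This one-sided estimate does the work of a Lipschitz condition. *)
Lemma median_field_monotone x y :
  \sum_i (x 0 i - y 0 i) * (f x 0 i - f y 0 i) <= 0.
Proof.
have -> : \sum_i (x 0 i - y 0 i) * (f x 0 i - f y 0 i) =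
    \sum_i (s i)%:R * ((x 0 i - y 0 i) * (sgn (z i - x 0 i) - sgn (z i - y 0 i)))
    - gamma * dirichlet e (x - y).
  rewrite /dirichlet mulrN opprK mulr_sumr -big_split/=; apply: eq_bigr => i _.
  have -> : lap e (x - y) i = lap e x i - lap e y i.
    by rewrite /lap -sumrB; apply: eq_bigr => j _; rewrite !mxE; ring.
  by rewrite !median_fieldE !mxE; ring.
rewrite subr_le0; apply: le_trans (_ : 0 <= _).
  by apply: sumr_le0 => i _; rewrite mulr_ge0_le0// sgn_monotone.
by rewrite mulr_ge0 ?(ltW gamma_gt0)// dirichlet_ge0.
Qed.

(** Linear growth rate of the field in the sup norm: 1 for the sign, [2 * gamma] for each of at most
    N differences. *)
Definition growth : R := 1 + gamma * (N%:R * 2).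

Lemma growth_ge1 : 1 <= growth.
Proof. by rewrite /growth lerDl mulr_ge0 ?(ltW gamma_gt0)// mulr_ge0// ler0n. Qed.

Lemma median_field_bound y (B : R) : (forall j, `|y 0 j| + 1 <= B) ->
  forall i, `|f y 0 i| <= growth * B.
Proof.
move=> yB i; have B1 : 1 <= B by have := yB i; have := normr_ge0 (y 0 i); lra.
rewrite median_fieldE; apply: le_trans (ler_normD _ _) _.
have h1 : `|(s i)%:R * sgn (z i - y 0 i)| <= 1.
  have := sgn_bound (z i - y 0 i).
  by case: (s i); rewrite ?mul1r ?mul0r ?normr0 ?ler_norml; lra.
have h2 : `|gamma * lap e y i| <= gamma * (N%:R * (2 * B)).
  rewrite normrM gtr0_norm// ler_pM2l// /lap.
  apply: le_trans (ler_norm_sum _ _ _) _.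
  apply: le_trans (_ : \sum_(j < N) (2 * B) <= _); last first.
    by rewrite sumr_const card_ord -[_ *+ N]mulr_natl.
  rewrite big_mkcond; apply: ler_sum => j _; case: ifP => _; last by lra.
  by apply: le_trans (ler_normB _ _) _; have := yB i; have := yB j; lra.
rewrite /growth; lra.
Qed.

(* Step [4^-n]: the distance of Euler polygons is of the order of the square root
   of the step, hence [2^-n]. *)
Definition mesh n : R := (2^-1 ^+ n) ^+ 2.

Lemma mesh_gt0 n : 0 < mesh n.
Proof. by rewrite exprn_gt0// exprn_gt0// invr_gt0. Qed.

Lemma meshD n k : mesh n = (4 ^ k)%N%:R * mesh (n + k).
Proof.
rewrite /mesh natrX exprD [in RHS]exprMn mulrCA -[(_ ^+ k) ^+ 2]exprM mulnC exprM.
by rewrite -exprMn [X in X ^+ k](_ : _ = 1) ?expr1n ?mulr1//; field.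
Qed.

Fixpoint euler n k : 'rV[R]_N :=
  if k is k'.+1 then euler n k' + mesh n *: f (euler n k') else x0.

Lemma eulerS n k i :
  euler n k.+1 0 i = euler n k 0 i + mesh n * f (euler n k) 0 i.
Proof. by rewrite /= !mxE. Qed.

Definition radius (T : R) : R := (`|x0| + 1) * expR (growth * T).

Lemma radius_ge1 T : 0 <= T -> 1 <= radius T.
Proof.
move=> T0; rewrite /radius; have := normr_ge0 x0 => h.
have h2 : 1 <= expR (growth * T).
  by rewrite -expR0 ler_expR mulr_ge0//; have := growth_ge1; lra.
by rewrite -[leLHS]mulr1 ler_pM//; lra.
Qed.

(** Discrete Gronwall: one step multiplies the bound on the entries, increased by 1, by at most
    [1 + growth * mesh n], which the exponential dominates. *)
Lemma euler_bound n k T : k%:R * mesh n <= T ->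
  forall i, `|euler n k 0 i| + 1 <= radius T.
Proof.
move=> kT i; have g1 := growth_ge1; have h0 := mesh_gt0 n.
suff h : forall i, `|euler n k 0 i| + 1 <=
    (`|x0| + 1) * (1 + growth * mesh n) ^+ k.
  apply: le_trans (h i) _; rewrite /radius ler_wpM2l ?addr_ge0//.
  apply: (@le_trans _ _ (expR (growth * mesh n) ^+ k)).
    by apply: lerXn2r; rewrite ?nnegrE ?expR_ge0 ?expR_ge1Dx// addr_ge0// mulr_ge0//; lra.
  rewrite -expRM_natl ler_expR mulrCA ler_pM2l//; lra.
elim: k {kT} => [|k IH] {}i.
  by rewrite expr0 mulr1 lerD2r entry_le_norm.
have := median_field_bound IH i => hf.
have := IH i; rewrite eulerS exprSr; set B := _ * _ ^+ k in hf *.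
move=> h1; apply: (@le_trans _ _ (`|euler n k 0 i| + mesh n * `|f (euler n k) 0 i| + 1)).
  rewrite lerD2r; apply: le_trans (ler_normD _ _) _.
  by rewrite normrM (gtr0_norm h0).
rewrite mulrA -/B.
have : mesh n * `|f (euler n k) 0 i| <= mesh n * (growth * B) by rewrite ler_pM2l.
lra.
Qed.

Definition speed T : R := growth * radius T.

Lemma speed_ge1 T : 0 <= T -> 1 <= speed T.
Proof.
move=> T0; have := radius_ge1 T0; have := growth_ge1 => h1 h2.
by rewrite -[leLHS]mulr1 /speed ler_pM.
Qed.

Lemma euler_speed n k T : k%:R * mesh n <= T ->
  forall i, `|f (euler n k) 0 i| <= speed T.
Proof. by move=> kT; apply: median_field_bound; exact: euler_bound. Qed.

Lemma entryB x y i : (x - y) 0 i = x 0 i - y 0 i.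
Proof. by rewrite !mxE. Qed.

(* The coarse Euler polygon, evaluated at the nodes of the finer mesh. *)
Fixpoint coarse n k j : 'rV[R]_N :=
  if j is j'.+1 then
    coarse n k j' + mesh (n + k) *: f (euler n (j' %/ 4 ^ k))
  else x0.

(** The value [r = 4 ^ k] is included because it starts the next coarse step in the induction on
    [q]. *)
Lemma coarseE n k q r i : (r <= 4 ^ k)%N ->
  coarse n k (q * 4 ^ k + r) 0 i =
  euler n q 0 i + r%:R * mesh (n + k) * f (euler n q) 0 i.
Proof.
have K0 : (0 < 4 ^ k)%N by rewrite expn_gt0.
elim: q r i => [|q IHq].
  elim=> [|r IHr] i rK; first by rewrite mul0n !mul0r addr0.
  rewrite addnS /= 2!mxE IHr ?(ltnW rK)// mul0n add0n divn_small//.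
  by rewrite -natr1; ring.
elim=> [|r IHr] i rK.
  rewrite addn0 mulSn addnC IHq// mul0r mul0r addr0 eulerS.
  by rewrite -meshD.
rewrite addnS /= 2!mxE IHr ?(ltnW rK)// divnMDl// divn_small// addn0.
by rewrite -natr1; ring.
Qed.

Lemma natr_mesh n k q : q%:R * mesh n = (q * 4 ^ k)%:R * mesh (n + k).
Proof. by rewrite natrM -mulrA -meshD. Qed.

Lemma fine_node n k j (T : R) : j%:R * mesh (n + k) <= T ->
  (j %/ 4 ^ k)%:R * mesh n <= T.
Proof.
apply: le_trans; rewrite (natr_mesh n k) ler_pM2r ?mesh_gt0//.
by rewrite ler_nat leq_divM.
Qed.

Lemma coarse_near n k j (T : R) i : j%:R * mesh (n + k) <= T ->
  `|coarse n k j 0 i - euler n (j %/ 4 ^ k) 0 i| <= mesh n * speed T.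
Proof.
move=> jT; have K0 : (0 < 4 ^ k)%N by rewrite expn_gt0.
have rK := ltn_pmod j K0.
rewrite {1}(divn_eq j (4 ^ k)) coarseE ?(ltnW rK)//.
rewrite addrAC subrr add0r normrM ler_pM//.
  rewrite ger0_norm ?mulr_ge0 ?(ltW (mesh_gt0 _))// [leRHS](meshD n k).
  by rewrite ler_pM2r ?mesh_gt0// ler_nat ltnW.
exact: euler_speed (fine_node jT) _.
Qed.

Lemma mesh_le n k : mesh (n + k) <= mesh n.
Proof.
rewrite [leRHS](meshD n k) -[leLHS]mul1r ler_pM2r ?mesh_gt0// ler1n expn_gt0//.
Qed.

(** Monotonicity applies to [X - Y], where the field is evaluated, and not to the actual difference
    [P - Y]. Replacing [P] by [X] costs [4 * N%:R * h * h' * M ^+ 2] per step, and so does the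
    quadratic term since [h' <= h]; hence the 8. *)
Lemma coarse_fine n k j (T : R) : 0 <= T -> j%:R * mesh (n + k) <= T ->
  sqnorm (coarse n k j - euler (n + k) j) <=
  8 * N%:R * speed T ^+ 2 * mesh n * (j%:R * mesh (n + k)).
Proof.
move=> T0; set h := mesh n; set h' := mesh (n + k); set M := speed T.
have M0 : 0 <= M by have := speed_ge1 T0; rewrite -/M; lra.
have h0 : 0 < h := mesh_gt0 n; have h'0 : 0 < h' := mesh_gt0 (n + k).
have h'h : h' <= h := mesh_le n k.
elim: j => [|j IH] jT.
  rewrite mul0r mulr0 /sqnorm big1// => i _; rewrite !mxE subrr expr0n//.
have jT' : j%:R * h' <= T.
  by apply: le_trans jT; rewrite ler_pM2r// ler_nat.
set X := euler n (j %/ 4 ^ k); set Y := euler (n + k) j; set P := coarse n k j.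
have fX i : `|f X 0 i| <= M by exact: euler_speed (fine_node jT') i.
have fY i : `|f Y 0 i| <= M by exact: euler_speed jT' i.
have PX i : `|P 0 i - X 0 i| <= h * M by exact: coarse_near.
have -> : coarse n k j.+1 - euler (n + k) j.+1 = (P - Y) + h' *: (f X - f Y).
  by apply/rowP => i; rewrite /= !mxE -/P -/X -/Y -/h'; ring.
rewrite sqnormD; have {IH} := IH jT'; rewrite -/P -/Y => IH.
have b1 : \sum_i (f X - f Y) 0 i * (P - Y) 0 i <= N%:R * (2 * h * M ^+ 2).
  apply: le_trans (_ : \sum_i (P 0 i - X 0 i) * (f X 0 i - f Y 0 i) +
     \sum_i (X 0 i - Y 0 i) * (f X 0 i - f Y 0 i) <= _).
    rewrite -big_split/= le_eqVlt; apply/orP; left; apply/eqP.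
    by apply: eq_bigr => i _; rewrite !entryB; ring.
  have mono := median_field_monotone X Y.
  suff : \sum_i (P 0 i - X 0 i) * (f X 0 i - f Y 0 i) <= N%:R * (2 * h * M ^+ 2).
    by lra.
  apply: le_trans (_ : \sum_(i < N) (h * M) * (2 * M) <= _); last first.
    rewrite sumr_const card_ord -[_ *+ N]mulr_natl le_eqVlt.
    by apply/orP; left; apply/eqP; ring.
  apply: ler_sum => i _; apply: le_trans (ler_norm _) _; rewrite normrM.
  rewrite ler_pM//; apply: le_trans (ler_normB _ _) _.
  by have := fX i; have := fY i; lra.
have b2 : sqnorm (f X - f Y) <= N%:R * (4 * M ^+ 2).
  apply: le_trans (_ : \sum_(i < N) (2 * M) ^+ 2 <= _); last first.
    rewrite sumr_const card_ord -[_ *+ N]mulr_natl le_eqVlt.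
    by apply/orP; left; apply/eqP; ring.
  apply: ler_sum => i _; rewrite !entryB.
  rewrite -[leLHS]real_normK ?num_real//; apply: lerXn2r; rewrite ?nnegrE//.
    by rewrite mulr_ge0.
  by apply: le_trans (ler_normB _ _) _; have := fX i; have := fY i; lra.
have c1 : 2 * h' * (\sum_i (f X - f Y) 0 i * (P - Y) 0 i) <=
    2 * h' * (N%:R * (2 * h * M ^+ 2)) by rewrite ler_pM2l// mulr_gt0.
have c2 : h' ^+ 2 * sqnorm (f X - f Y) <= (h * h') * (N%:R * (4 * M ^+ 2)).
  rewrite ler_pM ?sqr_ge0//; first by apply: sumr_ge0 => i _; rewrite sqr_ge0.
  by rewrite expr2 ler_pM2r.
rewrite -natr1; lra.
Qed.

Definition step n : R := 2^-1 ^+ n.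

Lemma step_gt0 n : 0 < step n.
Proof. by rewrite exprn_gt0// invr_gt0. Qed.

Lemma mesh_le_step n : mesh n <= step n.
Proof.
by rewrite /mesh expr2 -[leRHS]mulr1 ler_pM2l ?step_gt0// exprn_ile1//; lra.
Qed.

(** The 1 is the distance to the preceding coarse node; the other term crudely bounds the square
    root of [8 * N%:R * T] arising from [coarse_fine]. *)
Definition rate T : R := speed T * (1 + 8 * N%:R * (T + 1)).

Lemma rate_ge0 T : 0 <= T -> 0 <= rate T.
Proof.
move=> T0; have M1 := speed_ge1 T0.
have NT0 : 0 <= N%:R * (T + 1) by rewrite mulr_ge0//; lra.
by rewrite mulr_ge0//; lra.
Qed.

Lemma euler_fine n k j (T : R) i : 0 <= T -> j%:R * mesh (n + k) <= T ->
  `|euler n (j %/ 4 ^ k) 0 i - euler (n + k) j 0 i| <= rate T * step n.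
Proof.
move=> T0 jT; have M1 := speed_ge1 T0; set M := speed T in M1.
have N1 : 1 <= N%:R :> R by rewrite ler1n.
have s0 := step_gt0 n.
have h1 : `|coarse n k j 0 i - euler (n + k) j 0 i| <= 8 * N%:R * (T + 1) * M * step n.
  have c0 : 0 <= 8 * N%:R * (T + 1) * M * step n.
    have NT0 : 0 <= N%:R * (T + 1) by rewrite mulr_ge0//; lra.
    have Ms0 : 0 <= M * step n by rewrite mulr_ge0//; lra.
    have : 0 <= (N%:R * (T + 1)) * (M * step n) by exact: mulr_ge0.
    lra.
  rewrite -(@ler_pXn2r _ 2) ?nnegrE//.
  rewrite real_normK ?num_real//.
  have := sqr_entry_le_sqnorm (coarse n k j - euler (n + k) j) i.
  rewrite !entryB => /le_trans; apply.
  apply: le_trans (coarse_fine T0 jT) _; rewrite -/M.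
  have -> : (8 * N%:R * (T + 1) * M * step n) ^+ 2 =
     8 * N%:R * M ^+ 2 * mesh n * (8 * N%:R * (T + 1) ^+ 2).
    by rewrite /mesh -/(step n); ring.
  rewrite ler_wpM2l//.
    by rewrite mulr_ge0 ?(ltW (mesh_gt0 n))// mulr_ge0 ?sqr_ge0// mulr_ge0.
  apply: (le_trans jT).
  have : 0 <= (N%:R - 1) * (T + 1) ^+ 2 by rewrite mulr_ge0 ?sqr_ge0//; lra.
  have := sqr_ge0 T; lra.
have h2 := coarse_near i jT; rewrite -/M in h2.
have h3 : mesh n * M <= step n * M.
  by rewrite ler_wpM2r ?mesh_le_step//; lra.
have -> : euler n (j %/ 4 ^ k) 0 i - euler (n + k) j 0 i =
   - (coarse n k j 0 i - euler n (j %/ 4 ^ k) 0 i) +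
   (coarse n k j 0 i - euler (n + k) j 0 i) by ring.
apply: le_trans (ler_normD _ _) _; rewrite normrN /rate -/M; lra.
Qed.

Definition node n (t : R) : nat := Num.truncn (t / mesh n).

Lemma node_itv n t : 0 <= t ->
  (node n t)%:R * mesh n <= t < (node n t)%:R * mesh n + mesh n.
Proof.
move=> t0; have h0 := mesh_gt0 n.
have /truncn_itv/andP[h1 h2] : 0 <= t / mesh n by rewrite divr_ge0// ltW.
rewrite -ler_pdivlMr// h1/=.
by move: h2; rewrite ltr_pdivrMr// -natr1 mulrDl mul1r.
Qed.

Lemma node_mono n t u : t <= u -> (node n t <= node n u)%N.
Proof. by move=> tu; apply: le_truncn; rewrite ler_pM2r// invr_gt0 mesh_gt0. Qed.

Lemma node_div n k t : 0 <= t -> node n t = (node (n + k) t %/ 4 ^ k)%N.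
Proof.
move=> t0; have K0 : (0 < 4 ^ k)%N by rewrite expn_gt0.
have h0 := mesh_gt0 n; have h'0 := mesh_gt0 (n + k).
have /andP[j1 j2] := node_itv (n + k) t0.
set j := node (n + k) t in j1 j2 *.
apply: truncn_def; rewrite ler_pdivlMr// ltr_pdivrMr// !(natr_mesh n k).
apply/andP; split.
  by apply: le_trans j1; rewrite ler_pM2r// ler_nat leq_divM.
apply: lt_le_trans j2 _; rewrite -{2}[mesh _]mul1r -mulrDl natr1 ler_pM2r//.
by rewrite ler_nat ltn_ceil.
Qed.

(** Piecewise constant interpolation: its jumps are of the order of the mesh and disappear in the
    limit, which is Lipschitz. *)
Definition approx n t i : R := euler n (node n t) 0 i.

Lemma approx_cauchy n k t (T : R) i : 0 <= t <= T ->
  `|approx n t i - approx (n + k) t i| <= rate T * step n.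
Proof.
move=> /andP[t0 tT]; rewrite /approx (node_div n k t0); apply: euler_fine.
  exact: le_trans t0 tT.
by have /andP[h _] := node_itv (n + k) t0; exact: le_trans tT.
Qed.

Lemma step_small (c eps : R) : 0 < eps ->
  exists n, forall m, (n <= m)%N -> c * step m < eps.
Proof.
move=> e0.
have : c * step m @[m --> \oo] --> c * 0.
  by apply: cvgM; [exact: cvg_cst|apply: cvg_expr; rewrite ger0_norm; lra].
rewrite mulr0 => /cvgrPdist_lt/(_ _ e0)[n _ hn]; exists n => m nm.
have := hn m nm; rewrite /= sub0r normrN; exact: le_lt_trans (ler_norm _).
Qed.

Definition sol t : 'rV[R]_N := \row_i lim (approx n t i @[n --> \oo]).

Lemma approx_cvg t i : 0 <= t -> cvgn (fun n => approx n t i).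
Proof.
move=> t0; apply/cauchy_cvgP/cauchy_exP => eps e0.
have [n hn] := step_small (rate t) e0.
exists (approx n t i); exists n => // m /= nm; rewrite /ball/=.
rewrite -(subnKC nm); apply: le_lt_trans (hn n (leqnn n)).
by apply: approx_cauchy; rewrite t0 lexx.
Qed.

Lemma approx_sol n t (T : R) i : 0 <= t <= T ->
  `|approx n t i - sol t 0 i| <= rate T * step n.
Proof.
move=> /[dup] tT /andP[t0 _]; rewrite mxE.
have lim_le : `|approx n t i - approx m t i| @[m --> \oo] -->
    `|approx n t i - lim (approx m t i @[m --> \oo])|.
  by apply: cvg_norm; apply: cvgB; [exact: cvg_cst|exact: approx_cvg].
rewrite -(cvg_lim _ lim_le)//; apply: limr_le.
  by apply/cvg_ex; eexists; exact: lim_le.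
exists n => // m /= nm; rewrite -(subnKC nm); exact: approx_cauchy.
Qed.

Lemma approx_speed n t u (T : R) i : 0 <= t -> t <= u -> u <= T ->
  `|approx n u i - approx n t i| <= speed T * (u - t + mesh n).
Proof.
move=> t0 tu uT; have u0 := le_trans t0 tu; have T0 := le_trans u0 uT.
have h0 := mesh_gt0 n.
have M1 := speed_ge1 T0.
have /andP[t1 t2] := node_itv n t0; have /andP[u1 u2] := node_itv n u0.
have tun := node_mono n tu.
set p := node n t in t1 t2 tun *; set q := node n u in u1 u2 tun *.
have key r : (p + r <= q)%N ->
    `|euler n (p + r) 0 i - euler n p 0 i| <= speed T * (r%:R * mesh n).
  elim: r => [|r IH] prq; first by rewrite addn0 subrr normr0 mul0r mulr0.
  rewrite addnS eulerS addrAC; apply: le_trans (ler_normD _ _) _.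
  have := IH (ltnW _); rewrite -addnS => /(_ prq) h1.
  have h2 : `|f (euler n (p + r)) 0 i| <= speed T.
    apply: euler_speed; apply: le_trans uT; apply: le_trans u1.
    by rewrite ler_pM2r// ler_nat ltnW// -addnS.
  rewrite normrM (gtr0_norm h0) -natr1.
  have : mesh n * `|f (euler n (p + r)) 0 i| <= mesh n * speed T by rewrite ler_pM2l.
  lra.
have := key (q - p)%N; rewrite subnKC// leqnn => /(_ isT) /le_trans; apply.
rewrite ler_pM2l; last by lra.
rewrite natrB// mulrBl; lra.
Qed.

Lemma le_step_lim (a b c : R) : 0 <= c ->
  (forall n, a <= b + c * step n) -> a <= b.
Proof.
move=> c0 h; apply/ler_addgt0Pr => eps e0.
have [n /(_ n (leqnn n)) hn] := step_small c e0.
by have := h n; lra.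
Qed.

Lemma sol_lipschitz t u (T : R) i : 0 <= t -> t <= u -> u <= T ->
  `|sol u 0 i - sol t 0 i| <= speed T * (u - t).
Proof.
move=> t0 tu uT; have T0 : 0 <= T by lra.
have M1 := speed_ge1 T0; have r0 := rate_ge0 T0.
apply: (@le_step_lim _ _ (2 * rate T + speed T)) => [|n]; first by lra.
have := approx_speed n i t0 tu uT.
have tT : 0 <= t <= T by lra.
have uT' : 0 <= u <= T by lra.
have := approx_sol n i tT; have := approx_sol n i uT'.
have : speed T * mesh n <= speed T * step n.
  by rewrite ler_pM2l ?mesh_le_step//; lra.
rewrite !ler_norml; lra.
Qed.

Lemma sol0 : sol 0 = x0.
Proof.
apply/rowP => i; rewrite mxE; apply/cvg_lim => //.
have -> : (fun n => approx n 0 i) = (fun=> x0 0 i).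
  by apply/funext => n; rewrite /approx /node mul0r truncn0.
exact: cvg_cst.
Qed.

Local Notation lo := (median_lo e z s gamma).
Local Notation hi := (median_hi e z s gamma).

Lemma sol_slope t0 (eps : R) : 0 <= t0 -> 0 < eps ->
  exists2 delta : R, 0 < delta & forall t u, 0 <= t -> t0 - delta < t ->
    t <= u -> u < t0 + delta -> forall i,
    (lo (sol t0) i - eps) * (u - t) <= sol u 0 i - sol t 0 i <=
    (hi (sol t0) i + eps) * (u - t).
Proof.
move=> t00 e0.
have [d d0 hd] := median_field_near e z s N_gt0 gamma_gt0 (sol t0) e0.
have [T TE] : exists T, T = t0 + 1 by exists (t0 + 1).
have T0 : 0 <= T by lra.
have M1 := speed_ge1 T0; have r0 := rate_ge0 T0.
have [M ME] : exists M, M = speed T by exists (speed T).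
rewrite -ME in M1.
(* A quarter of [d] is spent on the motion of the solution within [delta], half of it on the
   approximation error and the mesh. *)
have [delta [delta0 delta1 deltad]] : exists delta : R,
    [/\ 0 < delta, delta <= 1 & M * delta <= d / 4].
  exists (Num.min 1 (d / (4 * M))); split.
  - by rewrite lt_min ltr01 divr_gt0//; lra.
  - by rewrite ge_min lexx.
  apply: (@le_trans _ _ (M * (d / (4 * M)))).
    by rewrite ler_wpM2l ?ge_min ?lexx ?orbT//; lra.
  by rewrite le_eqVlt; apply/orP; left; apply/eqP; field; rewrite gt_eqF//; lra.
exists delta => // t u tt0 tl tu ul i.
have d20 : 0 < d / 2 by lra.
have [n0 hn0] := step_small (rate T + M) d20.
have near_node n q : (n0 <= n)%N -> (node n t <= q)%N -> (q < node n u)%N ->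
    forall j, `|sol t0 0 j - euler n q 0 j| < d.
  move=> n0n tq qu j; have h0 := mesh_gt0 n.
  have u0 : 0 <= u by lra.
  have /andP[t1 t2] := node_itv n tt0; have /andP[u1 u2] := node_itv n u0.
  have q0 : 0 <= q%:R * mesh n by rewrite mulr_ge0// ltW.
  have qu' : q%:R * mesh n <= u.
    by apply: le_trans u1; rewrite ler_pM2r// ler_nat ltnW.
  have qt' : t - mesh n < q%:R * mesh n.
    have : (node n t)%:R * mesh n <= q%:R * mesh n by rewrite ler_pM2r// ler_nat.
    lra.
  have qT : 0 <= q%:R * mesh n <= T by rewrite q0/=; lra.
  have := approx_sol n j qT.
  have -> : approx n (q%:R * mesh n) j = euler n q 0 j.
    by rewrite /approx /node mulfK ?gt_eqF// natrK.
  have lip : `|sol (q%:R * mesh n) 0 j - sol t0 0 j| <= M * (delta + mesh n).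
    have [_ qT'] := andP qT.
    have [le|/ltW le] := leP t0 (q%:R * mesh n).
      apply: le_trans (sol_lipschitz j t00 le qT') _.
      by rewrite -ME ler_wpM2l//; lra.
    have t0T : t0 <= T by lra.
    rewrite distrC; apply: le_trans (sol_lipschitz j q0 le t0T) _.
    by rewrite -ME ler_wpM2l//; lra.
  have := hn0 n n0n.
  have : M * mesh n <= M * step n by rewrite ler_pM2l ?mesh_le_step//; lra.
  move: lip; rewrite !ler_norml ltr_norml; lra.
have sum_bound n : (n0 <= n)%N ->
    ((node n u)%:R - (node n t)%:R) * mesh n * (lo (sol t0) i - eps)
      <= approx n u i - approx n t i <=
    ((node n u)%:R - (node n t)%:R) * mesh n * (hi (sol t0) i + eps).
  move=> n0n; have tun := node_mono n tu; have h0 := mesh_gt0 n.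
  have key r : (node n t + r <= node n u)%N ->
    r%:R * mesh n * (lo (sol t0) i - eps) <=
      euler n (node n t + r) 0 i - euler n (node n t) 0 i <=
    r%:R * mesh n * (hi (sol t0) i + eps).
    elim: r => [|r IH] prq; first by rewrite addn0 subrr !mul0r lexx.
    rewrite addnS eulerS [X in _ <= X <= _]addrAC.
    have := IH (ltnW _); rewrite -addnS => /(_ prq).
    rewrite addnS in prq.
    have /andP[f1 f2] := hd _ (near_node n _ n0n (leq_addr r _) prq) i.
    have : mesh n * (lo (sol t0) i - eps) <= mesh n * f (euler n (node n t + r)) 0 i.
      by rewrite ler_pM2l.
    have : mesh n * f (euler n (node n t + r)) 0 i <= mesh n * (hi (sol t0) i + eps).
      by rewrite ler_pM2l.
    rewrite -natr1; lra.
  by have := key (node n u - node n t)%N; rewrite subnKC// leqnn natrB// => /(_ isT).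
have u0 : 0 <= u by lra.
have uT : 0 <= u <= T by lra.
have tT : 0 <= t <= T by lra.
have node_diff n : `|((node n u)%:R - (node n t)%:R) * mesh n - (u - t)| <= step n.
  have /andP[t1 t2] := node_itv n tt0; have /andP[u1 u2] := node_itv n u0.
  have := mesh_le_step n; rewrite ler_norml mulrBl; lra.
(* Before [n0] the inequality follows from the one at [n0], because the step is larger there. *)
have lim_n0 (a b c : R) : 0 <= c ->
    (forall n, (n0 <= n)%N -> a <= b + c * step n) -> a <= b.
  move=> c0 h; apply: (@le_step_lim _ _ c c0) => n.
  have [/h//|nn0] := leqP n0 n.
  apply: le_trans (h n0 (leqnn n0)) _; rewrite lerD2l ler_wpM2l//.
  rewrite /step -(subnKC (ltnW nn0)) exprD -[leRHS]mulr1 ler_pM2l ?step_gt0//.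
  by rewrite exprn_ile1//; lra.
have scale n (c : R) : `|((node n u)%:R - (node n t)%:R) * mesh n * c - c * (u - t)|
    <= `|c| * step n.
  rewrite [X in `|X|](_ : _ = c * (((node n u)%:R - (node n t)%:R) * mesh n - (u - t))).
    by rewrite normrM ler_wpM2l.
  by ring.
apply/andP; split.
  apply: (lim_n0 _ _ (2 * rate T + `|lo (sol t0) i - eps|)) => [|n n0n].
    by have := normr_ge0 (lo (sol t0) i - eps); lra.
  have := scale n (lo (sol t0) i - eps); have := sum_bound n n0n.
  have := approx_sol n i uT; have := approx_sol n i tT.
  move: (lo (sol t0) i - eps) => c; rewrite !ler_norml.
  move: (_ * mesh n * c) => Q; move: (`|c|) (c * (u - t)) => c' c''; lra.
apply: (lim_n0 _ _ (2 * rate T + `|hi (sol t0) i + eps|)) => [|n n0n].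
  by have := normr_ge0 (hi (sol t0) i + eps); lra.
have := scale n (hi (sol t0) i + eps); have := sum_bound n n0n.
have := approx_sol n i uT; have := approx_sol n i tT.
move: (lo _ _ - eps) (hi _ _ + eps) => b c; rewrite !ler_norml.
move: (_ * mesh n * c) => Q; move: (`|c|) (c * (u - t)) => c' c''; lra.
Qed.

End Euler.

(** * Density points and derivatives *)

Section Density.
Variable R : realType.
Local Notation mu := (@lebesgue_measure R).

(** A ball of radius [eps * rho] around [t] free of [A] would occupy the fraction [eps / 2] of the
    ball of radius [2 * rho] around [x], against a density above [1 - eps / 2]. The bound [eps <= 1]
    keeps the first ball inside the second. *)
Lemma density_point_near (A : set R) : measurable A ->
  {ae mu, forall x, A x -> forall eps : R, 0 < eps <= 1 ->
    exists2 delta : R, 0 < delta & forall t, 0 < `|t - x| < delta ->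
      exists2 u, A u & `|u - t| < eps * `|t - x|}.
Proof.
move=> mA; apply: ae_sub (lebesgue_density mA) => x dx Ax eps /andP[e0 e1].
rewrite indicE mem_set// in dx.
have : nbhs (1%R%:E : \bar R) [set y | ((1 - eps / 2)%:E < y)%E].
  by apply: open_nbhs_nbhs; split; [exact: open_ereal_gt_ereal|rewrite /= lte_fin; lra].
move=> /dx; rewrite /nbhs/= => /nbhs_ballP[r0 /= r00 hr].
exists (r0 / 2); first by lra.
move=> t /andP[tx0 tx]; set rho := `|t - x| in tx0 tx *.
apply: contrapT => nex.
have nA u : ball t (eps * rho) u -> ~ A u.
  by rewrite /ball/= distrC => ut Au; apply: nex; exists u.
have er0 : 0 < eps * rho by rewrite mulr_gt0.
have er1 : eps * rho <= rho by rewrite -[leRHS]mul1r ler_pM2r.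
have sub : ball t (eps * rho) `<=` ball x (2 * rho).
  move=> u; rewrite /ball/= => ut.
  have := ler_normD (t - u) (- (t - x)); rewrite normrN -/rho.
  have -> : t - u - (t - x) = x - u by ring.
  lra.
pose B : set R := ball x (2 * rho); pose b : set R := ball t (eps * rho).
have mB : measurable B by exact: measurable_ball.
have mb : measurable b by exact: measurable_ball.
have mAB : measurable (A `&` B) by exact: measurableI.
have muB : mu B = (4 * rho)%:E.
  by rewrite lebesgue_measure_ball; [congr EFin; ring|lra].
have mub : mu b = (2 * (eps * rho))%:E.
  by rewrite lebesgue_measure_ball; [congr EFin; ring|lra].
have : (mu (A `&` B) + mu b <= mu B)%E.
  have dAb : A `&` B `&` b = set0 by apply/seteqP; split=> u //= [[Au _]] /nA.
  apply: le_trans (_ : mu ((A `&` B) `|` b) <= _)%E.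
    by have <- := measureU mu mAB mb dAb.
  apply: le_measure; rewrite ?inE//; first exact: measurableU.
  by move=> u [[]//|/sub].
have : ((1 - eps / 2)%:E < mu (A `&` B) * (mu B)^-1)%E.
  by apply: hr; rewrite /ball/= ?sub0r ?normrN ?gtr0_norm; lra.
rewrite muB mub.
have fA : mu (A `&` B) \is a fin_num.
  rewrite ge0_fin_numE//; apply: (@le_lt_trans _ _ (mu B)).
    by apply: le_measure; rewrite ?inE.
  by rewrite muB ltry.
rewrite -(fineK fA); move: (fine _) => m.
rewrite inver ifF; last by rewrite gt_eqF//; lra.
rewrite -EFinM -EFinD lte_fin lee_fin ltr_pdivlMr; last by lra.
lra.
Qed.

End Density.

Section DerivableSlope.
Variables (R : realType).
Implicit Types (g : R -> R) (t l : R).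

Lemma derivable_of_slope g t l :
  (forall eps : R, 0 < eps -> exists2 delta : R, 0 < delta &
    forall u, 0 < `|u - t| < delta -> `|g u - g t - l * (u - t)| <= eps * `|u - t|) ->
  derivable g t 1.
Proof.
move=> h; apply/cvg_ex; exists l; apply/cvgrPdist_le => eps e0.
have [d d0 hd] := h eps e0.
rewrite /dnbhs /within/=; apply/nbhs_ballP; exists d => //= u.
rewrite /ball/= sub0r normrN => ud un.
have := hd (u + t); rewrite addrK normr_gt0 un ud => /(_ isT) hu.
rewrite /GRing.scale/= mulr1 distrC.
have -> : u^-1 * (g (u + t) - g t) - l = (g (u + t) - g t - l * u) / u.
  by field.
by rewrite normrM normfV ler_pdivrMr ?normr_gt0.
Qed.

Lemma derivable_slope g t : derivable g t 1 ->
  forall eps : R, 0 < eps -> exists2 delta : R, 0 < delta &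
    forall u, 0 < `|u - t| < delta ->
      `|g u - g t - derive1 g t * (u - t)| <= eps * `|u - t|.
Proof.
move=> dg eps e0; rewrite derive1E.
have /cvgrPdist_le /(_ _ e0) : h^-1 *: (g (h *: 1 + t) - g t) @[h --> 0^']
   --> 'D_1 g t by exact: dg.
rewrite /dnbhs /within/= => /nbhs_ballP[delta /= d0 hd]; exists delta => // u.
move=> /andP[ut0 ut]; have un : u - t != 0 by rewrite -normr_gt0.
have := hd (u - t); rewrite /ball/= sub0r normrN => /(_ ut un).
rewrite /GRing.scale/= mulr1 subrK distrC -(ler_pM2r ut0) -normrM.
by congr (`|_| <= _); field.
Qed.

Lemma derive1_of_slope g t (a b : R) : derivable g t 1 ->
  (forall eps : R, 0 < eps -> exists2 delta : R, 0 < delta &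
    forall u, t <= u -> u < t + delta ->
      (a - eps) * (u - t) <= g u - g t <= (b + eps) * (u - t)) ->
  a <= derive1 g t <= b.
Proof.
move=> dg h.
suff key (eps : R) : 0 < eps -> a - 2 * eps <= derive1 g t <= b + 2 * eps.
  apply/andP; split; apply/ler_addgt0Pr => eps e0;
    have e2 : 0 < eps / 2 by lra.
    by have /andP[] := key _ e2; lra.
  by have /andP[] := key _ e2; lra.
move=> e0; have [d1 d10 h1] := h eps e0.
have [d2 d20 h2] := derivable_slope dg e0.
have [w [w0 w1 w2]] : exists w, [/\ 0 < w, w < d1 & w < d2].
  exists (Num.min d1 d2 / 2).
  have m0 : 0 < Num.min d1 d2 by rewrite lt_min d10.
  have m1 : Num.min d1 d2 <= d1 by rewrite ge_min lexx.
  have m2 : Num.min d1 d2 <= d2 by rewrite ge_min lexx orbT.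
  by split; lra.
have := h1 (t + w); have := h2 (t + w); rewrite addrAC subrr add0r gtr0_norm//.
rewrite w0 w2 ler_norml => /(_ isT)/andP[p1 p2] /(_ _ _)/andP[||q1 q2]; try lra.
by apply/andP; split; rewrite -(ler_pM2r w0); lra.
Qed.

Lemma derive1_entry_of_slope (N : nat) (y : R -> 'rV[R]_N) t i (a b : R) :
  derivable y t 1 ->
  (forall eps : R, 0 < eps -> exists2 delta : R, 0 < delta &
    forall u, t <= u -> u < t + delta ->
      (a - eps) * (u - t) <= y u 0 i - y t 0 i <= (b + eps) * (u - t)) ->
  a <= derive1 y t 0 i <= b.
Proof.
move=> dy h; rewrite -derive1_entry//; apply: derive1_of_slope => //.
exact: (@ex_derive _ _ _ _ _ _ _ (is_derive_entry dy i)).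
Qed.

End DerivableSlope.

Section Existence.
Variables (R : realType) (N : nat) (e : rel 'I_N).
Variables (z : 'I_N -> R) (s : 'I_N -> bool) (gamma : R) (x0 : 'rV[R]_N).
Hypotheses (N_gt0 : (0 < N)%N) (gamma_gt0 : 0 < gamma) (e_sym : symmetric e).
Local Notation mu := (@lebesgue_measure R).
Local Notation f := (median_field e z s gamma).
Local Notation x := (sol e z s gamma x0).
Local Notation lo := (median_lo e z s gamma).
Local Notation hi := (median_hi e z s gamma).

Lemma sol_abs_continuous T : 0 <= T -> abs_continuous_on x 0 T.
Proof.
move=> T0 eps e0; set M := speed gamma x0 T.
have M1 : 1 <= M by exact: speed_ge1.
have M0 : 0 < M by lra.
exists (eps / M) => [|n c d cd _]; first by rewrite divr_gt0.
rewrite ltr_pdivlMr// mulrC mulr_sumr; apply: le_lt_trans.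
apply: ler_sum => k _; have [c0 [cdk dT]] := cd k (ltn_ord k).
rewrite [leLHS]/Num.Def.normr/= mx_normrE bigmax_le//.
  by rewrite mulr_ge0 ?subr_ge0// ltW.
by move=> [i j] _ /=; rewrite (ord1 i) entryB; exact: sol_lipschitz.
Qed.

(** Clamping time at 0 extends the solution continuously to the whole line, so that the surface
    times form a closed set. *)
Lemma sol_entry_measurable i :
  measurable ([set t | x (Num.max t 0) 0 i = z i] : set R).
Proof.
apply: closed_measurable.
apply: (@preimage_closed _ _ (fun t : R => x (Num.max t 0) 0 i) [set z i]);
  last exact: closed_eq.
move=> t _; apply/cvgrPdist_le => eps e0.
pose T := Num.max t 0 + 1; set M := speed gamma x0 T.
have T0 : 0 <= T by rewrite addr_ge0// le_max lexx orbT.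
have M1 : 1 <= M by exact: speed_ge1.
have M0 : 0 < M by lra.
have d0 : 0 < Num.min 1 (eps / M) by rewrite lt_min ltr01 divr_gt0.
apply/nbhs_ballP; exists (Num.min 1 (eps / M)) => //= u; rewrite /ball/= lt_min.
move=> /andP[tu1 tu2].
have max_le a b : a <= b -> Num.max a 0 <= Num.max b 0 /\
    Num.max b 0 - Num.max a 0 <= b - a :> R.
  by move=> ab; case: (leP a 0) => ?; case: (leP b 0) => ?; split; lra.
have max0 a : 0 <= Num.max a 0 :> R by rewrite le_max lexx orbT.
have bnd : M * `|t - u| <= eps.
  by rewrite mulrC -ler_pdivlMr// ltW.
have [tu|/ltW ut] := leP t u.
  have [h1 h2] := max_le _ _ tu.
  move: bnd tu1; rewrite distrC (ger0_norm (_ : 0 <= u - t)) ?subr_ge0// => bnd tu1.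
  rewrite distrC; apply: le_trans (_ : M * (Num.max u 0 - Num.max t 0) <= _).
    by apply: sol_lipschitz => //; rewrite /T; lra.
  by apply: le_trans bnd; rewrite ler_pM2l.
have [h1 h2] := max_le _ _ ut.
move: bnd tu1; rewrite (ger0_norm (_ : 0 <= t - u)) ?subr_ge0// => bnd tu1.
apply: le_trans (_ : M * (Num.max t 0 - Num.max u 0) <= _).
  by apply: sol_lipschitz => //; rewrite /T; lra.
by apply: le_trans bnd; rewrite ler_pM2l.
Qed.

(** What is used of [t] being a density point of the surface times; as an implication it holds at
    almost every [t], on the surface or not. *)
Definition dense_on_surface (t : R) i : Prop :=
  x (Num.max t 0) 0 i = z i -> forall eps : R, 0 < eps <= 1 ->
    exists2 delta : R, 0 < delta & forall u, 0 < `|u - t| < delta ->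
      exists2 w, x (Num.max w 0) 0 i = z i & `|w - u| < eps * `|u - t|.

Lemma dense_on_surface_ae : {ae mu, forall t i, dense_on_surface t i}.
Proof.
(* The finite union over coordinates is padded with empty sets to a countable one. *)
pose bad (k : nat) : set R :=
  if insub k is Some i then [set t | ~ dense_on_surface t i] else set0.
have : mu.-negligible (\bigcup_k bad k).
  apply: negligible_bigcup => k; rewrite /bad; case: insubP => [i _ _|_].
    exact: (density_point_near (sol_entry_measurable i)).
  exact: negligible_set0.
apply: negligibleS => t /= /existsNP[i nt].
by exists (val i) => //; rewrite /bad valK.
Qed.

Lemma sol_entry_derivable t i : 0 < t -> dense_on_surface t i ->
  derivable (fun u => x u 0 i) t 1.
Proof.
move=> t0 dense_t.
have [loE|lohi] := eqVneq (lo (x t) i) (hi (x t) i).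
  apply: (@derivable_of_slope _ _ _ (lo (x t) i)) => eps e0.
  have [d d0 hd] := sol_slope z s x0 N_gt0 gamma_gt0 e_sym (ltW t0) e0.
  exists (Num.min d t) => [|u]; first by rewrite lt_min d0.
  rewrite lt_min => /andP[ut0 /andP[ud ut]].
  move: ud ut; rewrite !ltr_norml => ud ut.
  have [tu|/ltW tu] := leP t u.
    have := hd t u (ltW t0) _ tu _ i; rewrite -loE => /(_ _ _)/andP[||]; try lra.
    by rewrite (ger0_norm (_ : 0 <= u - t)) ?subr_ge0// ler_norml; lra.
  have := hd u t _ _ tu _ i; rewrite -loE => /(_ _ _ _)/andP[|||]; try lra.
  by rewrite (ler0_norm (_ : u - t <= 0)) ?subr_le0// ler_norml; lra.
have xz : x t 0 i = z i.
  apply/eqP; apply: contra_neqT lohi => xz; rewrite /median_lo /median_hi.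
  by case: ltgtP xz.
(* A surface time [w] near [u] carries the same value as [t], so the increment from [t] to [u] is at
   most [M] times the distance of [w] and [u], and [eps'] absorbs [M]. *)
apply: (@derivable_of_slope _ _ _ 0) => eps e0.
have [T TE] : exists T, T = t + t + t + t by exists (t + t + t + t).
have T0 : 0 <= T by lra.
have [M ME] : exists M, M = speed gamma x0 T by exists (speed gamma x0 T).
have M1 : 1 <= M by rewrite ME; exact: speed_ge1.
pose eps' := Num.min 1 (eps / M).
have e'0 : 0 < eps' by rewrite lt_min ltr01 divr_gt0//; lra.
have e'1 : eps' <= 1 by rewrite ge_min lexx.
have e'M : M * eps' <= eps.
  by rewrite mulrC -ler_pdivlMr ?ge_min ?lexx ?orbT//; lra.
have tmax : Num.max t 0 = t by apply/max_idPl; exact: ltW.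
have [||d d0 hd] := dense_t _ eps' _; [by rewrite tmax|by rewrite e'0|].
exists (Num.min d (t / 2)) => [|u]; first by rewrite lt_min d0/=; lra.
rewrite lt_min => /andP[ut0 /andP[ud ut]].
have [|w xw wu] := hd u; first by rewrite ut0.
have wu1 : `|w - u| < `|u - t|.
  by apply: lt_le_trans wu _; rewrite -[leRHS]mul1r ler_pM2r.
have uw : [/\ 0 < u, u <= T, 0 < w & w <= T].
  have wut : `|w - u| < t / 2 by exact: lt_trans ut.
  clear - t0 ut wut TE; move: ut wut; rewrite !ltr_norml => h1 h2.
  by split; lra.
have [u0 uT w0 wT] := uw.
rewrite mul0r subr0 xz -xw (_ : Num.max w 0 = w); last by apply/max_idPl; exact: ltW.
apply: (@le_trans _ _ (M * `|w - u|)).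
  have [wu'|/ltW wu'] := leP w u.
    rewrite (ler0_norm (_ : w - u <= 0)) ?subr_le0// opprB ME.
    by apply: sol_lipschitz => //; exact: ltW.
  rewrite (ger0_norm (_ : 0 <= w - u)) ?subr_ge0// ME distrC.
  by apply: sol_lipschitz => //; exact: ltW.
apply: (@le_trans _ _ (M * (eps' * `|u - t|))).
  by rewrite ler_pM2l ?ltW//; lra.
by rewrite mulrA ler_wpM2r.
Qed.

Lemma sol_filippov : filippov_solution f x.
Proof.
split; first exact: sol_abs_continuous.
(* Time 0 is discarded: the slope bounds concern nonnegative times, so only a one-sided derivative
   is controlled there. *)
have n0 : mu.-negligible [set (0 : R)].
  by exists [set 0]; split => //; exact: lebesgue_measure_set1.
have := negligibleU n0 dense_on_surface_ae; apply: negligibleS => t /= nt.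
have [->|tn0] := eqVneq t 0; first by left.
right => dense_t; apply: nt => t_ge0.
have t0 : 0 < t by rewrite lt_def tn0.
have dx : derivable x t 1.
  apply/derivable_mxP => j i; rewrite (ord1 j).
  exact: sol_entry_derivable (dense_t i).
split; first exact: dx.
apply/(filippov_medianE e z s N_gt0 gamma_gt0) => i.
apply: (derive1_entry_of_slope dx) => eps e0.
have [d d0 hd] := sol_slope z s x0 N_gt0 gamma_gt0 e_sym t_ge0 e0.
have td : t - d < t by rewrite ltrBlDr ltrDl.
by exists d; [exact: d0|move=> u tu ud; exact: (hd t u t_ge0 td tu ud i)].
Qed.

End Existence.

Unset Implicit Arguments.

Theorem theorem1 (R : realType) (N : nat) (hN : (0 < N)%N)
  (e : rel 'I_N) (e_sym : symmetric e) (e_conn : forall i j, connect e i j)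
  (ev : seq R)
  (ev_char : char_poly (laplacian R e) = \prod_(a <- ev) ('X - a%:P))
  (ev_sorted : sorted <=%R ev)
  (z : 'I_N -> R) (s : 'I_N -> bool) (s_some : exists i, s i)
  (gamma : R) (gamma_pos : 0 < gamma) :
  let lambda2 := ev`_1 in
  let f := median_field e z s gamma in
  forall x0 : 'rV[R]_N,
    (exists x : R -> 'rV[R]_N, filippov_solution f x /\ x 0 = x0) /\
    (forall x : R -> 'rV[R]_N, filippov_solution f x -> x 0 = x0 ->
       forall eps : R, 0 < eps -> exists T : R, forall t : R, T <= t ->
         forall i : 'I_N,
           dist_set (x t 0 i) (median_set z s)
             <= 2 * Num.sqrt (N%:R) / (gamma * lambda2) + eps).
Proof.
move=> lambda2 f x0; split.
  exists (sol e z s gamma x0); split; last exact: sol0.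
  exact: sol_filippov hN gamma_pos e_sym.
move=> x xsol _ eps eps0.
exact: (filippov_limsup hN e_sym e_conn ev_char ev_sorted s_some gamma_pos xsol eps0).
Qed.
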